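(* For any arbitrarily small constant $\epsilon>0$, there is a polynomial-time algorithm that computes a feasible solution to the linear program LP(Hopset) whose objective value is at most $(1+\epsilon)$ times the optimal value of LP(Hopset).
   Context: Let $G=(V,E)$ be a directed graph with $n=|V|$, edge lengths $\ell:E\to\{1,\dots,\mathrm{poly}(n)\}$, demand pairs $\mathcal{D}\subseteq V\times V$, distance bounds $Dist:\mathcal{D}\to\mathbb{N}_{\ge0}$, and hopbound $\beta$. Let $G_M=(V,E_M)$ be the weighted transitive closure of $G$ ($(u,v)\in E_M$ iff $v$ is reachable from $u$, with length $d_G(u,v)$), and $\widetilde{E}=E_M\setminus E$. For $(s,t)\in\mathcal{D}$, let $\mathcal{P}_{s,t}$ be the set of $s$–$t$ paths in $G_M$ with at most $\beta$ edges and length at most $Dist(s,t)$, and $\mathcal{Z}_{s,t}=\{\mathbf{z}\in[0,1]^{|E_M|}: \sum_{e\in P} z_e\ge 1\ \forall P\in\mathcal{P}_{s,t}\}$. LP(Hopset) is: minimize $\sum_{e\in\widetilde{E}} x_e$ subject to $\sum_{e\in E_M} z_e x_e\ge 1$ for all $(s,t)\in\mathcal{D}$ and all $\mathbf{z}\in\mathcal{Z}_{s,t}$, and $x_e\ge 0$ for all $e\in E_M$. *)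

(* Defs.v *)
From mathcomp Require Import all_boot all_order all_algebra.
From mathcomp Require Import all_classical all_reals.

Set Implicit Arguments.
Unset Strict Implicit.
Unset Printing Implicit Defensive.

Import Order.TTheory GRing.Theory Num.Theory.

(* Polynomial time: while-programs on a random access machine with
    logarithmic cost

    Memory cells hold unbounded natural numbers and are addressed by natural
    numbers (indirect addressing through [Read] and [Write]).  As in the
    logarithmic-cost RAM, every operation is charged the bit-lengths of the
    values and of the addresses it handles, so that polynomial time is the
    same notion as for Turing machines. *)

Definition memory := nat -> nat.

Inductive expr :=
  | Const of nat
  | Read of expr
  | Add of expr & expr
  | Sub of expr & expr
  | Mul of expr & expr
  | Div of expr & expr.

Inductive program :=
  | Skip
  | Write of expr & expr
  | Seq of program & program
  | If of expr & program & program
  | While of expr & program.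

Definition bits (m : nat) : nat := (trunc_log 2 m).+1.

Fixpoint eval (s : memory) (e : expr) : nat :=
  match e with
  | Const c => c
  | Read a => s (eval s a)
  | Add a b => eval s a + eval s b
  | Sub a b => eval s a - eval s b
  | Mul a b => eval s a * eval s b
  | Div a b => eval s a %/ eval s b
  end.

Fixpoint cost (s : memory) (e : expr) : nat :=
  match e with
  | Const c => bits c
  | Read a => cost s a + bits (eval s a) + bits (s (eval s a))
  | Add a b | Sub a b | Mul a b | Div a b =>
      cost s a + cost s b + bits (eval s a) + bits (eval s b)
  end.

Definition update (s : memory) (a v : nat) : memory :=
  fun b => if b == a then v else s b.

(* [exec c s t s']: started in memory [s], the program [c] halts after time
   [t] in memory [s'].  A test succeeds when its value is nonzero. *)
Inductive exec : program -> memory -> nat -> memory -> Prop :=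
  | ExecSkip s : exec Skip s 1 s
  | ExecWrite s a e :
      exec (Write a e) s (cost s a + cost s e + bits (eval s a) + bits (eval s e))
        (update s (eval s a) (eval s e))
  | ExecSeq c1 c2 s s1 s2 t1 t2 :
      exec c1 s t1 s1 -> exec c2 s1 t2 s2 -> exec (Seq c1 c2) s (t1 + t2) s2
  | ExecIfTrue e c1 c2 s s1 t :
      eval s e != 0 -> exec c1 s t s1 ->
      exec (If e c1 c2) s (cost s e + bits (eval s e) + t) s1
  | ExecIfFalse e c1 c2 s s1 t :
      eval s e = 0 -> exec c2 s t s1 ->
      exec (If e c1 c2) s (cost s e + bits (eval s e) + t) s1
  | ExecWhileTrue e c s s1 s2 t1 t2 :
      eval s e != 0 -> exec c s t1 s1 -> exec (While e c) s1 t2 s2 ->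
      exec (While e c) s (cost s e + bits (eval s e) + t1 + t2) s2
  | ExecWhileFalse e c s :
      eval s e = 0 -> exec (While e c) s (cost s e + bits (eval s e)) s.

(* The input word occupies cells 0, 1, 2, ...; all other cells hold 0. *)
Definition input_memory (w : seq nat) : memory := fun a => nth 0 w a.

Definition word_size (w : seq nat) : nat := \sum_(a <- w) bits a.

(* Only the values of [len] on [edge] and of [Dist] on [demand] matter. *)
Record instance := Instance {
  nb_vertices : nat;
  edge : {set 'I_nb_vertices * 'I_nb_vertices};
  len : 'I_nb_vertices * 'I_nb_vertices -> nat;
  demand : {set 'I_nb_vertices * 'I_nb_vertices};
  Dist : 'I_nb_vertices * 'I_nb_vertices -> nat;
  hopbound : nat
}.

Notation pair_of I := ('I_(nb_vertices I) * 'I_(nb_vertices I))%type.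

Definition lengths_within (q : {poly nat}) (I : instance) : Prop :=
  forall e : pair_of I, e \in edge I ->
    1 <= len e <= q.[nb_vertices I]%R.

(* All pairs of vertices, in row-major order: [(u, v)] is at index
   [u * nb_vertices I + v]. *)
Definition vertex_pairs (I : instance) : seq (pair_of I) :=
  [seq (u, v) | u <- enum 'I_(nb_vertices I), v <- enum 'I_(nb_vertices I)].

(* Numbers count as written in binary, see [word_size].  Edge lengths are
   positive, so 0 encodes a non-edge; distance bounds may be 0 and are
   shifted by one. *)
Definition encode (I : instance) : seq nat :=
  [:: nb_vertices I; hopbound I]
  ++ [seq (if e \in edge I then len e else 0) | e <- vertex_pairs I]
  ++ [seq (if e \in demand I then (Dist e).+1 else 0) | e <- vertex_pairs I].

Definition steps (T : Type) (u : T) (p : seq T) : seq (T * T) := zip (u :: p) p.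

Definition edge_rel (I : instance) : rel 'I_(nb_vertices I) :=
  fun u v => (u, v) \in edge I.

Definition walk_lengths (I : instance) (u v : 'I_(nb_vertices I)) : set nat :=
  [set k | exists p, [/\ path (@edge_rel I) u p, last u p = v &
                         k = \sum_(e <- steps u p) len e]]%classic.

(* The distance from [u] to [v]; 0 (not infinity) if [v] is not reachable. *)
Definition dist (I : instance) (u v : 'I_(nb_vertices I)) : nat :=
  xget 0 [set k | walk_lengths u v k /\
                  forall j, walk_lengths u v j -> k <= j]%classic.

Definition closure_edge (I : instance) : {set pair_of I} :=
  [set e | connect (@edge_rel I) e.1 e.2].

Definition new_edge (I : instance) : {set pair_of I} :=
  closure_edge I :\: edge I.

Definition closure_rel (I : instance) : rel 'I_(nb_vertices I) :=
  fun u v => (u, v) \in closure_edge I.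

(* The path [st.1 :: p] belongs to the family P_st of the pair [st]. *)
Definition valid_path (I : instance) (st : pair_of I) (p : seq 'I_(nb_vertices I)) : Prop :=
  [/\ path (@closure_rel I) st.1 p, last st.1 p = st.2, uniq (st.1 :: p),
      size p <= hopbound I
    & \sum_(e <- steps st.1 p) dist e.1 e.2 <= Dist st].

Local Open Scope ring_scope.

(* Vectors indexed by the closure edges are functions on all pairs, whose
   values elsewhere are irrelevant. *)
Definition cut_vector (R : realType) (I : instance) (st : pair_of I)
    (z : pair_of I -> R) : Prop :=
  (forall e, e \in closure_edge I -> 0 <= z e <= 1) /\
  (forall p, valid_path st p -> 1 <= \sum_(e <- steps st.1 p) z e).

Definition LP_feasible (R : realType) (I : instance) (x : pair_of I -> R) : Prop :=
  (forall st, st \in demand I -> forall z, cut_vector st z ->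
     1 <= \sum_(e in closure_edge I) z e * x e) /\
  (forall e, e \in closure_edge I -> 0 <= x e).

Definition LP_objective (R : realType) (I : instance) (x : pair_of I -> R) : R :=
  \sum_(e in new_edge I) x e.

Definition LP_value (R : realType) (I : instance) : R :=
  inf [set LP_objective x | x in [set x | @LP_feasible R I x]]%classic.

(* The final memory represents the vector [x]: the entry at the [k]-th pair is
   the fraction whose numerator and denominator are in cells [2k], [2k+1]. *)
Definition represents (R : realType) (I : instance) (s : memory)
    (x : pair_of I -> R) : Prop :=
  forall u v : 'I_(nb_vertices I), let k := (u * nb_vertices I + v)%N in
    (0 < s (2 * k).+1)%N /\ x (u, v) = (s (2 * k)%N)%:R / (s (2 * k).+1)%:R.

(* Main.v *)
Require Import Defs.
From mathcomp Require Import all_boot all_order all_algebra.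
From mathcomp Require Import all_classical all_reals.
From mathcomp.analysis Require Import sequences exp.
From mathcomp Require Import zify ring lra.

(* By LP duality inside each demand, LP(Hopset) asks for a unit flow f_d on the
   valid paths of every demand d so that the sum over new edges e of
   max_d f_d(e) is minimal, i.e. for the value of a game in which an adversary
   picks, for every new edge, a distribution over the demands.  It is solved by
   multiplicative weights: the adversary keeps an integer weight W(d,e), started
   at 1; in every round each demand takes a valid walk that is cheapest for
   the normalised weights, and the weights of the edges it uses are multiplied by
   K+1, all others by K.  If C(d,e) counts the rounds in which d used e, then
   x_e = max_d C(d,e) / T is feasible after T rounds, because every walk meets
   every cut vector.  For a feasible x0, truncating (weights / cheapest cost) to
   [0,1] gives a cut vector, so each round costs at most (1+1/K) times the value
   of x0; hence the product over e of S_e / K^t, with S_e = sum_d W(d,e), is at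
   most exp (n^4 + t (1+1/K) val(x0) / K), whereas it is at least
   (1+1/K)^(sum_e max_d C(d,e)).  The additive error n^4 is harmless: either
   val(x0) >= 1, or every demand has a valid path of old edges and no new edge
   is ever used.

   Edge lengths are polynomial in n, so cheapest walks with bounded hops and
   length come from dynamic programming over (demand, length budget, vertex);
   each table entry carries the edge set of its walk, which avoids backtracking.
   Walks may revisit vertices, but contain a simple walk made of some of their
   own steps. *)

Set Implicit Arguments.
Unset Strict Implicit.
Unset Printing Implicit Defensive.

Import Order.TTheory GRing.Theory Num.Theory.
Local Open Scope nat_scope.

(** * A data-parallel language compiled to the random access machine *)

(* [HI e] reads input cell [e], or cell 0 when [e] is not an input address;
   [HJ] is the index of the enclosing [PTab]; [HG a e] is entry [e] of array [a]. *)
Inductive hexp :=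
  | HC of nat
  | HN
  | HI of hexp
  | HJ
  | HG of nat & hexp
  | HAdd of hexp & hexp
  | HSub of hexp & hexp
  | HMul of hexp & hexp
  | HDiv of hexp & hexp.

(* [PTab a P e] assigns all entries [j < P] of array [a] simultaneously;
   [PIter i P b] runs [b] with entry 0 of array [i] equal to P-1, ..., 1, 0. *)
Inductive prog :=
  | PTab of nat & hexp & hexp
  | PSeq of prog & prog
  | PIter of nat & hexp & prog.

Definition store := nat -> nat -> nat.

(* The arrays are interleaved beyond the input, array [a] in the cells of residue
   [a + 2] modulo [width]; residues 0 and 1 are a buffer and the counter [HJ]. *)
Definition width := 32.

Definition input_end : expr :=
  Add (Const 2) (Mul (Const 2) (Mul (Read (Const 0)) (Read (Const 0)))).

Definition cell (a : nat) (e : expr) : expr :=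
  Add input_end (Add (Const a) (Mul (Const width) e)).

(** With truncated subtraction this is 0 at 0 and 1 elsewhere. *)
Definition sign_exp (e : expr) : expr := Defs.Sub (Const 1) (Defs.Sub (Const 1) e).

Fixpoint compile_exp (e : hexp) : expr :=
  match e with
  | HC c => Const c
  | HN => Read (Const 0)
  | HI e => Read (Mul (compile_exp e) (sign_exp (Defs.Sub input_end (compile_exp e))))
  | HJ => Read (cell 1 (Const 0))
  | HG a e => Read (cell a.+2 (compile_exp e))
  | HAdd a b => Add (compile_exp a) (compile_exp b)
  | HSub a b => Defs.Sub (compile_exp a) (compile_exp b)
  | HMul a b => Mul (compile_exp a) (compile_exp b)
  | HDiv a b => Div (compile_exp a) (compile_exp b)
  end.

Definition for_loop (c be : expr) (body : program) : program :=
  Seq (Write c be)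
    (While (Read c) (Seq (Write c (Defs.Sub (Read c) (Const 1))) body)).

(** The first loop of a [PTab] fills the buffer and the second one copies it, so that every entry is
    computed from the old arrays. *)
Fixpoint compile (p : prog) : program :=
  match p with
  | PTab a P e =>
      Seq (for_loop (cell 1 (Const 0)) (compile_exp P)
             (Write (cell 0 (Read (cell 1 (Const 0)))) (compile_exp e)))
          (for_loop (cell 1 (Const 0)) (compile_exp P)
             (Write (cell a.+2 (Read (cell 1 (Const 0))))
                    (Read (cell 0 (Read (cell 1 (Const 0)))))))
  | PSeq p1 p2 => Seq (compile p1) (compile p2)
  | PIter i P b => for_loop (cell i.+2 (Const 0)) (compile_exp P) (compile b)
  end.

(** Loop bounds are restricted to these polynomials in the number of vertices, so that the number of
    operations can be read off the program. *)
Fixpoint nonly (e : hexp) : bool :=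
  match e with
  | HC _ | HN => true
  | HAdd a b | HMul a b => nonly a && nonly b
  | _ => false
  end.

Fixpoint hpoly (e : hexp) : {poly nat} :=
  match e with
  | HC c => c%:P%R
  | HN => 'X%R
  | HAdd a b => (hpoly a + hpoly b)%R
  | HMul a b => (hpoly a * hpoly b)%R
  | _ => 0%R
  end.

Fixpoint ids_ok (e : hexp) : bool :=
  match e with
  | HC _ | HN | HJ => true
  | HI e => ids_ok e
  | HG a e => (a.+2 < width) && ids_ok e
  | HAdd a b | HSub a b | HMul a b | HDiv a b => ids_ok a && ids_ok b
  end.

(** The degree in the memory contents. Input cells have degree 0, being bounded by the input size;
    differences and quotients inherit the bound of their first argument. *)
Fixpoint hdeg (e : hexp) : nat :=
  match e with
  | HC _ | HN | HI _ => 0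
  | HJ | HG _ _ => 1
  | HAdd a b => maxn (hdeg a) (hdeg b)
  | HMul a b => hdeg a + hdeg b
  | HSub a _ | HDiv a _ => hdeg a
  end.

(* With inputs below [2 ^ b0] and memory below [2 ^ b], the value of [e] is below
   [2 ^ (hgrowth e * b0 + hdeg e * b)]. *)
Fixpoint hgrowth (e : hexp) : nat :=
  match e with
  | HC c => c.+1
  | HN | HI _ => 1
  | HJ | HG _ _ => 0
  | HAdd a b => (hgrowth a + hgrowth b).+1
  | HMul a b => hgrowth a + hgrowth b
  | HSub a _ | HDiv a _ => hgrowth a
  end.

Fixpoint writes (p : prog) : seq nat :=
  match p with
  | PTab a _ _ => [:: a]
  | PSeq p1 p2 => writes p1 ++ writes p2
  | PIter i _ b => i :: writes b
  end.

Fixpoint well_formed (p : prog) : bool :=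
  match p with
  | PTab a P e => [&& a.+2 < width, nonly P, ids_ok e & hdeg e <= 1]
  | PSeq p1 p2 => well_formed p1 && well_formed p2
  | PIter i P b => [&& i.+2 < width, nonly P, i \notin writes b & well_formed b]
  end.

Definition set_counter (i k : nat) (s : store) : store :=
  fun a l => if (a == i) && (l == 0) then k else s a l.

Fixpoint iter_down (f : store -> store) (i : nat) (N : nat) (s : store) : store :=
  if N is k.+1 then iter_down f i k (f (set_counter i k s)) else set_counter i 0 s.

(** * Semantics of the language and its representation in memory *)

Section Semantics.
Variable w : seq nat.
Let n := nth 0 w 0.
Let X := 2 + 2 * (n * n).

Fixpoint heval (s : store) (j : nat) (e : hexp) : nat :=
  match e with
  | HC c => c
  | HN => n
  | HI e => nth 0 w (if heval s j e < X then heval s j e else 0)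
  | HJ => j
  | HG a e => s a (heval s j e)
  | HAdd a b => heval s j a + heval s j b
  | HSub a b => heval s j a - heval s j b
  | HMul a b => heval s j a * heval s j b
  | HDiv a b => heval s j a %/ heval s j b
  end.

Definition tab (a N : nat) (v : nat -> nat) (s : store) : store :=
  fun b k => if (b == a) && (k < N) then v k else s b k.

Fixpoint run (p : prog) (s : store) : store :=
  match p with
  | PTab a P e => tab a (heval s 0 P) (fun k => heval s k e) s
  | PSeq p1 p2 => run p2 (run p1 s)
  | PIter i P b => iter_down (run b) i (heval s 0 P) s
  end.

Definition addr (a k : nat) := X + (a + width * k).

Lemma addr_inj a k b l : a < width -> b < width ->
  (addr a k == addr b l) = (a == b) && (k == l).
Proof. by rewrite /addr /width => ha hb; apply/eqP/andP => [H|[/eqP-> /eqP->]] //; split; apply/eqP; lia. Qed.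

Lemma addr_geX a k : X <= addr a k.
Proof. exact: leq_addr. Qed.

(** Residues 0 and 1 beyond the input stay unconstrained: they are scratch space. *)
Definition models (m : memory) (s : store) : Prop :=
  (forall k, k < X -> m k = nth 0 w k) /\
  (forall a k, a.+2 < width -> m (addr a.+2 k) = s a k).

Lemma eval_cell m a e : m 0 = n -> eval m (cell a e) = addr a (eval m e).
Proof. by move=> h; rewrite /= h. Qed.

Lemma rel0 m s : models m s -> m 0 = n.
Proof. by case=> h _; rewrite h. Qed.

Lemma eval_compile_exp m s j e : models m s -> m (addr 1 0) = j -> ids_ok e ->
  eval m (compile_exp e) = heval s j e.
Proof.
move=> r hj; case: (r) => h1 h2.
have cl a e0 := eval_cell a e0 (rel0 r).
elim: e => [c||e IH||a e IH|a IHa b IHb|a IHa b IHb|a IHa b IHb|a IHa b IHb] //=.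
- by rewrite h1.
- move=> he; have := IH he.
  set v := eval m _ => ->.
  have -> : 2 + 2 * (m 0 * m 0) = X by rewrite h1.
  case: ltnP => hX; last first.
    have -> : heval s j e * (1 - (1 - (X - heval s j e))) = 0 by lia.
    by rewrite h1.
  by rewrite (_ : _ * _ = heval s j e) ?h1 //; lia.
- by move=> _; rewrite -hj; move: (cl 1 (Const 0)) => /= ->.
- by case/andP=> ha he; move: (cl a.+2 (compile_exp e)) => /= ->; rewrite IH // h2.
- by case/andP=> ha hb; rewrite IHa ?IHb.
- by case/andP=> ha hb; rewrite IHa ?IHb.
- by case/andP=> ha hb; rewrite IHa ?IHb.
- by case/andP=> ha hb; rewrite IHa ?IHb.
Qed.

Lemma nonly_hids e : nonly e -> ids_ok e.
Proof. by elim: e => //= a IHa b IHb /andP[/IHa-> /IHb->]. Qed.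

Lemma nonly_eval s j e : nonly e -> heval s j e = (hpoly e).[n]%R.
Proof.
elim: e => //=.
- by move=> c _; rewrite hornerC.
- by move=> _; rewrite hornerX.
- by move=> a IHa b IHb /andP[/IHa-> /IHb->]; rewrite hornerD.
- by move=> a IHa b IHb /andP[/IHa-> /IHb->]; rewrite hornerM.
Qed.

Lemma eval_compile_nonly m e : m 0 = n -> nonly e -> eval m (compile_exp e) = (hpoly e).[n]%R.
Proof.
move=> m0; elim: e => //=.
- by move=> c _; rewrite hornerC.
- by move=> _; rewrite hornerX.
- by move=> a IHa b IHb /andP[/IHa-> /IHb->]; rewrite hornerD.
- by move=> a IHa b IHb /andP[/IHa-> /IHb->]; rewrite hornerM.
Qed.

End Semantics.

Lemma nonly_degb e : nonly e -> hdeg e = 0.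
Proof. by elim: e => //= a IHa b IHb /andP[/IHa-> /IHb->]. Qed.

(** * Bit-lengths of values and costs of expressions *)

Lemma bits_le v k : 0 < k -> v < 2 ^ k -> bits v <= k.
Proof.
rewrite /bits => k0 h; case: v h => [|v] h; first by rewrite trunc_log0.
by rewrite -(ltn_exp2l _ _ (isT : 1 < 2)); apply: leq_ltn_trans h; exact: trunc_logP.
Qed.

Lemma expn2_add a b x y : 0 < x -> 0 < y -> a < 2 ^ x -> b < 2 ^ y ->
  a + b < 2 ^ (x + y).
Proof.
move=> x0 y0 ha hb; rewrite expnD.
have hx : 2 <= 2 ^ x by rewrite -{1}(expn1 2) leq_exp2l.
have hy : 2 <= 2 ^ y by rewrite -{1}(expn1 2) leq_exp2l.
nia.
Qed.

(** A read counts 1 whatever its address, because all cells are assumed below [2 ^ b]; values then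
    lie below [2 ^ (value_size e * b)]. *)
Fixpoint value_size (e : expr) : nat :=
  match e with
  | Const c => c.+1
  | Read _ => 1
  | Add a b | Mul a b => value_size a + value_size b
  | Defs.Sub a _ | Div a _ => value_size a
  end.

Fixpoint cost_size (e : expr) : nat :=
  match e with
  | Const c => c.+1
  | Read a => cost_size a + value_size a + 1
  | Add a b | Defs.Sub a b | Mul a b | Div a b => cost_size a + cost_size b + value_size a + value_size b
  end.

Definition cells (m : memory) (b : nat) : Prop := forall k, m k < 2 ^ b.

Lemma value_size_gt0 e : 0 < value_size e.
Proof. by elim: e => //= a IHa b IHb; rewrite addn_gt0 IHa. Qed.

Lemma eval_bound m b e : 0 < b -> cells m b -> eval m e < 2 ^ (value_size e * b).
Proof.
move=> b0 hm; elim: e => [c|a IHa|a IHa c IHc|a IHa c IHc|a IHa c IHc|a IHa c IHc] /=.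
- apply: (@leq_trans (2 ^ c.+1)); last by rewrite leq_exp2l // leq_pmulr.
  by apply: (ltn_trans (ltnSn c)); exact: ltn_expl.
- by rewrite mul1n; exact: hm.
- by rewrite mulnDl; apply: expn2_add => //; rewrite muln_gt0 value_size_gt0.
- by apply: leq_ltn_trans IHa; exact: leq_subr.
- by rewrite mulnDl expnD; apply: ltn_mul.
- by apply: leq_ltn_trans IHa; exact: leq_div.
Qed.

Lemma bits_eval m b e : 0 < b -> cells m b -> bits (eval m e) <= value_size e * b.
Proof. by move=> b0 hm; apply: bits_le; rewrite ?muln_gt0 ?value_size_gt0 //; exact: eval_bound. Qed.

Lemma cost_bound m b e : 0 < b -> cells m b -> cost m e <= cost_size e * b.
Proof.
move=> b0 hm.
have B e' := bits_eval e' b0 hm.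
elim: e => [c|a IHa|a IHa c IHc|a IHa c IHc|a IHa c IHc|a IHa c IHc] /=.
- exact: (B (Const c)).
- rewrite !mulnDl mul1n leq_add ?leq_add //.
  by apply: bits_le.
- by rewrite !mulnDl !leq_add.
- by rewrite !mulnDl !leq_add.
- by rewrite !mulnDl !leq_add.
- by rewrite !mulnDl !leq_add.
Qed.

(** Input bits are kept apart from memory bits: when [hdeg e <= 1] the bit-length grows by an
    additive term, whereas [eval_bound] multiplies it by a constant, which would be exponential
    under iteration. *)
Lemma heval_bound w s j e b0 b : 0 < b0 -> 0 < b ->
  (forall k, nth 0 w k < 2 ^ b0) -> (forall a k, a.+2 < width -> s a k < 2 ^ b) -> j < 2 ^ b ->
  ids_ok e ->
  heval w s j e < 2 ^ (hgrowth e * b0 + hdeg e * b).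
Proof.
move=> b00 bgt hw hs hj.
elim: e => [c||e _||a e _|a IHa c IHc|a IHa c IHc|a IHa c IHc|a IHa c IHc] /=.
- move=> _; apply: (@leq_trans (2 ^ c.+1)).
    by apply: (ltn_trans (ltnSn c)); exact: ltn_expl.
  by rewrite leq_exp2l // mul0n addn0 leq_pmulr.
- by rewrite mul1n mul0n addn0.
- by rewrite mul1n mul0n addn0.
- by rewrite mul0n mul1n.
- by case/andP=> ha _; rewrite mul0n mul1n; exact: hs.
- case/andP=> /IHa ha /IHc hc.
  set u := _ * b0 + _ * b.
  (* The successor in [hgrowth] pays for the carry of the addition. *)
  have u1 : (hgrowth a * b0 + hdeg a * b).+1 <= u by rewrite /u; nia.
  have u2 : (hgrowth c * b0 + hdeg c * b).+1 <= u by rewrite /u; nia.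
  have l1 : 2 ^ (hgrowth a * b0 + hdeg a * b).+1 <= 2 ^ u by rewrite leq_exp2l.
  have l2 : 2 ^ (hgrowth c * b0 + hdeg c * b).+1 <= 2 ^ u by rewrite leq_exp2l.
  by move: l1 l2; rewrite !expnS; lia.
- by case/andP=> /IHa ha _; apply: leq_ltn_trans ha; exact: leq_subr.
- case/andP=> /IHa ha /IHc hc.
  by rewrite !mulnDl addnACA expnD ltn_mul.
- by case/andP=> /IHa ha _; apply: leq_ltn_trans ha; exact: leq_div.
Qed.

(** * Hoare triples with a count of operations *)

Section Triples.
Variables al ga b0 : nat.
Hypothesis b0_gt0 : 0 < b0.

(* Total correctness in [N] elementary operations: each one adds at most [al]
   bits to the stored values, so that its cost stays at most [ga * (b + al * N)]. *)
Definition triple (P : memory -> Prop) (c : program) (N : nat) (Q : memory -> Prop) :=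
  forall m b, b0 <= b -> cells m b -> P m ->
  exists t m', [/\ exec c m t m', cells m' (b + al * N), Q m'
                 & t <= N * (ga * (b + al * N))].

Lemma triple_seq P c1 N1 Q c2 N2 S : triple P c1 N1 Q -> triple Q c2 N2 S ->
  triple P (Seq c1 c2) (N1 + N2) S.
Proof.
move=> h h' m b hb hm hP; have [t [m' [h1 h2 h3 h4]]] := h m b hb hm hP.
have [|t' [m'' [k1 k2 k3 k4]]] := h' m' (b + al * N1) _ h2 h3.
  by apply: leq_trans hb _; exact: leq_addr.
exists (t + t'), m''; split=> //.
- exact: ExecSeq h1 k1.
- by move=> k; rewrite mulnDr addnA; exact: k2.
rewrite mulnDl leq_add //.
  apply: leq_trans h4 _; rewrite leq_mul2l leq_mul2l leq_add2l leq_mul2l.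
  by rewrite leq_addr !orbT.
by apply: leq_trans k4 _; rewrite -addnA -mulnDr.
Qed.

Lemma update_neq m a v b : b != a -> update m a v b = m b.
Proof. by rewrite /update => /negbTE ->. Qed.

Lemma update_eq m a v : update m a v a = v.
Proof. by rewrite /update eqxx. Qed.

Lemma cells_update m b a v : cells m b -> v < 2 ^ b -> cells (update m a v) b.
Proof. by move=> hm hv k; rewrite /update; case: ifP. Qed.

Lemma cells_mono m b b' : b <= b' -> cells m b -> cells m b'.
Proof. by move=> hb hm k; apply: leq_trans (hm k) _; rewrite leq_exp2l. Qed.

Lemma triple_write (P Q : memory -> Prop) a e :
  cost_size a + cost_size e + value_size a + value_size e <= ga ->
  (forall m, P m -> Q (update m (eval m a) (eval m e))) ->
  (forall m b, b0 <= b -> cells m b -> P m -> eval m e < 2 ^ (b + al)) ->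
  triple P (Write a e) 1 Q.
Proof.
move=> hg hQ hv m b hb hm hP.
have bgt := leq_trans b0_gt0 hb.
exists (cost m a + cost m e + bits (eval m a) + bits (eval m e)), (update m (eval m a) (eval m e)).
split.
- exact: ExecWrite.
- rewrite muln1; apply: cells_update; last exact: hv.
  by apply: cells_mono hm; exact: leq_addr.
- exact: hQ.
rewrite mul1n muln1; apply: (@leq_trans (ga * b)); last by rewrite leq_mul2l leq_addr orbT.
apply: leq_trans (leq_mul hg (leqnn b)).
by rewrite !mulnDl !leq_add ?cost_bound ?bits_eval.
Qed.

(** [Inv k] describes the state before the test when the counter is k. Test and decrement make the 2
    operations added to each iteration; the initial write and the failing test make the last 2. The
    8 covers the constants in the cost of the decrement. *)
Lemma triple_for (P : memory -> Prop) (Inv : nat -> memory -> Prop) c be body N0 N1 ad :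
  cost_size c + cost_size be + value_size c + value_size be <= ga ->
  cost_size c + cost_size c + value_size c + value_size c + 8 <= ga ->
  (forall m, P m -> [/\ eval m c = ad, eval m be = N0 & Inv N0 (update m ad N0)]) ->
  (forall m b, b0 <= b -> cells m b -> P m -> N0 < 2 ^ (b + al)) ->
  (forall k m, Inv k m -> eval m c = ad /\ m ad = k) ->
  (forall k, k < N0 ->
     triple (fun m => exists2 m0, Inv k.+1 m0 & m = update m0 ad k) body N1 (Inv k)) ->
  triple P (for_loop c be body) (N0 * (N1 + 2) + 2) (Inv 0).
Proof.
move=> hg1 hg2 hP hN hI hb.
have -> : N0 * (N1 + 2) + 2 = 1 + (N0 * (N1 + 2) + 1) by lia.
apply: (triple_seq (Q := Inv N0)).
  apply: triple_write => //.
    by move=> m /hP[-> -> ].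
  by move=> m b hb' hm /[dup] hPm /hP[_ -> _]; exact: hN hPm.
have hwhile m b : b0 <= b -> cells m b ->
    cost m (Read c) + bits (eval m (Read c)) <= ga * b.
  move=> hb' hm; have bgt := leq_trans b0_gt0 hb'.
  apply: (@leq_trans ((cost_size (Read c) + value_size (Read c)) * b)).
    by rewrite mulnDl leq_add ?cost_bound ?bits_eval.
  by rewrite leq_mul2r; apply/orP; right; move: hg2 => /=; lia.
elim: N0 hb {hP hN} => [|N IH] hb.
  move=> m b hb' hm hInv.
  exists (cost m (Read c) + bits (eval m (Read c))), m; split=> //.
  - by apply: ExecWhileFalse => /=; have [-> ->] := hI _ _ hInv.
  - by apply: cells_mono hm; exact: leq_addr.
  rewrite mul0n add0n mul1n.
  by apply: leq_trans (hwhile _ _ hb' hm) _; rewrite leq_mul2l leq_addr orbT.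
have hbody : triple (Inv N.+1) (Seq (Write c (Defs.Sub (Read c) (Const 1))) body) (1 + N1) (Inv N).
  apply: triple_seq (hb N (ltnSn N)).
  apply: triple_write => /=; first by lia.
    move=> m hInv; have [h1 h2] := hI _ _ hInv.
    by exists m => //; rewrite h1 h2 subn1.
  move=> m b hb' hm hInv.
  apply: (@leq_ltn_trans (m (eval m c))); first exact: leq_subr.
  by apply: leq_trans (hm _) _; rewrite leq_exp2l // leq_addr.
have {}IH := IH (fun k hk => hb k (ltnW hk)).
move=> m b hb' hm hInv.
have [t [m' [h1 h2 h3 h4]]] := hbody m b hb' hm hInv.
have hb'' : b0 <= b + al * (1 + N1) by apply: leq_trans hb' _; exact: leq_addr.
have [t' [m'' [k1 k2 k3 k4]]] := IH m' _ hb'' h2 h3.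
exists (cost m (Read c) + bits (eval m (Read c)) + t + t'), m''; split=> //.
- apply: ExecWhileTrue h1 k1 => /=; by have [-> ->] := hI _ _ hInv.
- by apply: cells_mono k2; rewrite -addnA -mulnDr leq_add2l leq_mul2l; apply/orP; right; lia.
set E := N.+1 * (N1 + 2) + 1.
have -> : E * (ga * (b + al * E)) =
   1 * (ga * (b + al * E)) + (1 + N1) * (ga * (b + al * E)) + (N * (N1 + 2) + 1) * (ga * (b + al * E)).
  by rewrite -!mulnDl; congr (_ * _); rewrite /E; lia.
apply: leq_add; first apply: leq_add.
- rewrite mul1n; apply: leq_trans (hwhile _ _ hb' hm) _.
  by rewrite leq_mul2l leq_addr orbT.
- apply: leq_trans h4 _; rewrite !leq_mul2l leq_add2l leq_mul2l /E.
  by apply/orP; right; apply/orP; right; apply/orP; right; lia.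
- apply: leq_trans k4 _; rewrite !leq_mul2l -addnA -mulnDr leq_add2l leq_mul2l /E.
  by apply/orP; right; apply/orP; right; apply/orP; right; lia.
Qed.

Lemma triple_conseq (P P' Q Q' : memory -> Prop) c N :
  (forall m, P' m -> P m) -> (forall m, Q m -> Q' m) -> triple P c N Q -> triple P' c N Q'.
Proof.
move=> hP hQ h m b hb hm /hP hPm; have [t [m' [h1 h2 /hQ h3 h4]]] := h m b hb hm hPm.
by exists t, m'.
Qed.

End Triples.

(** * Correctness and cost of the compiled programs *)

Fixpoint program_size (c : program) : nat :=
  match c with
  | Skip => 0
  | Write a e => cost_size a + cost_size e + value_size a + value_size e
  | Seq c1 c2 => program_size c1 + program_size c2
  | If e c1 c2 => cost_size e + program_size c1 + program_size c2
  | While e c => (cost_size e + program_size c).+1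
  end.

Fixpoint growth (p : prog) : nat :=
  match p with
  | PTab _ P e => hgrowth P + hgrowth e
  | PSeq p1 p2 => growth p1 + growth p2
  | PIter _ P b => hgrowth P + growth b
  end.

(** The counts of [triple_for]; a [PTab] is two loops whose bodies are single writes. *)
Fixpoint step_poly (p : prog) : {poly nat} :=
  match p with
  | PTab _ P e => (hpoly P * 3%:P + 2%:P + (hpoly P * 3%:P + 2%:P))%R
  | PSeq p1 p2 => (step_poly p1 + step_poly p2)%R
  | PIter _ P b => (hpoly P * (step_poly b + 2%:P) + 2%:P)%R
  end.

Section Compile.
Variable w : seq nat.
Let n := nth 0 w 0.
Let X := 2 + 2 * (n * n).
Variables al ga b0 : nat.
Hypothesis b0_gt0 : 0 < b0.
Hypothesis w_bound : forall k, nth 0 w k < 2 ^ b0.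

Notation models := (models w).
Notation addr := (addr w).
Notation heval := (heval w).
Notation run := (run w).
Notation triple := (triple al ga b0).

Lemma frame p s a k : a \notin writes p -> run p s a k = s a k.
Proof.
elim: p s => [b P e|p1 IH1 p2 IH2|i P b IH] s /=.
- by rewrite inE /tab => /negbTE ->.
- by rewrite mem_cat negb_or => /andP[h1 h2]; rewrite IH2 // IH1.
rewrite inE negb_or => /andP[/negbTE ai hb].
move: (heval s 0 P) => N; elim: N s => [|N IHN] s /=; first by rewrite /set_counter ai.
by rewrite IHN IH // /set_counter ai.
Qed.

Lemma rel_ext m s s' : (forall a k, s a k = s' a k) -> models m s -> models m s'.
Proof. by move=> h [h1 h2]; split=> // a k ha; rewrite -h h2. Qed.

Lemma update_addr_X m a l v : (forall k, k < X -> m k = nth 0 w k) ->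
  forall k, k < X -> update m (addr a l) v k = nth 0 w k.
Proof.
move=> h k hk; rewrite /update ifF ?h //; apply/negbTE.
by have := addr_geX w a l; rewrite -/n -/X; lia.
Qed.

Lemma update_addr m a l v b k : a < width -> b < width ->
  update m (addr a l) v (addr b k) = if (b == a) && (k == l) then v else m (addr b k).
Proof. by move=> ha hb; rewrite /update addr_inj. Qed.

Lemma rel_update_reserved m s a k v : a < 2 -> models m s -> models (update m (addr a k) v) s.
Proof.
move=> ha [h1 h2]; split; first exact: update_addr_X.
move=> b l hb; rewrite update_addr //; last by rewrite /width; lia.
by rewrite ifF ?h2 //; apply/negbTE; lia.
Qed.

Lemma rel_update m s a k v : a.+2 < width -> models m s ->
  models (update m (addr a.+2 k) v) (fun b l => if (b == a) && (l == k) then v else s b l).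
Proof.
move=> ha [h1 h2]; split; first exact: update_addr_X.
by move=> b l hb; rewrite update_addr // !eqSS h2.
Qed.

Lemma nonly_bound s P b : nonly P -> hgrowth P * b0 <= al -> heval s 0 P < 2 ^ (b + al).
Proof.
move=> hP hal.
have -> : heval s 0 P = heval (fun _ _ => 0) 0 P by rewrite !nonly_eval.
apply: (@leq_trans (2 ^ (hgrowth P * b0 + hdeg P * 1))).
  by apply: heval_bound => //; exact: nonly_hids.
by rewrite leq_exp2l // nonly_degb // mul0n addn0; apply: leq_trans hal _; exact: leq_addl.
Qed.

(** The state of the first loop of a [PTab]: entries from k on are in the buffer, the arrays are
    unchanged. *)
Definition tmpInv (s : store) (v : nat -> nat) N k m :=
  [/\ models m s, m (addr 1 0) = k & forall i, k <= i < N -> m (addr 0 i) = v i].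

Lemma models_eval_cell m s a e : models m s -> eval m (cell a e) = addr a (eval m e).
Proof. by move=> /rel0; exact: eval_cell. Qed.

Lemma compile_tab a P e s : well_formed (PTab a P e) -> growth (PTab a P e) * b0 <= al ->
  program_size (compile (PTab a P e)) <= ga ->
  triple (models^~ s) (compile (PTab a P e)) (step_poly (PTab a P e)).[n]%R (models^~ (run (PTab a P e) s)).
Proof.
move=> /and4P[ha hP he hdeg1] hal hga.
set N := heval s 0 P; pose v k := heval s k e.
have NE s' : heval s' 0 P = N by rewrite /N !nonly_eval.
have wd1 : 1 < width by [].
have evP m s' : models m s' -> eval m (compile_exp P) = N.
  move=> h; rewrite (@eval_compile_exp w m s' (m (addr 1 0))) ?nonly_hids //.
  by rewrite -(NE s') !nonly_eval.
have hPal : hgrowth P * b0 <= al by apply: leq_trans hal; rewrite leq_mul2r leq_addr orbT.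
have -> : (step_poly (PTab a P e)).[n]%R = (N * (1 + 2) + 2) + (N * (1 + 2) + 2).
  by rewrite /= !hornerD !hornerM !hornerC /N nonly_eval.
have evJ m s' : models m s' -> eval m (Read (cell 1 (Const 0))) = m (addr 1 0).
  by move=> h /=; have := models_eval_cell 1 (Const 0) h => /= ->.
move: hga; rewrite [compile _]/=; set c := cell 1 (Const 0) => hga.
apply: (triple_seq (Q := tmpInv s v N 0)).
  apply: (triple_for b0_gt0 (ad := addr 1 0)).
  - by move: hga => /=; lia.
  - by move: hga => /=; lia.
  - move=> m h; split; first exact: (models_eval_cell 1 (Const 0) h).
      exact: evP h.
    split; first exact: rel_update_reserved.
      by rewrite update_addr.
    by move=> i; lia.
  - by move=> m b _ _ _; exact: nonly_bound.
  - by move=> k m [h1 h2 h3]; split=> //; exact: (models_eval_cell 1 (Const 0) h1).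
  move=> k hk; apply: triple_write => //.
  - by move: hga => /=; lia.
  - move=> _ [m0 [h1 h2 h3] ->].
    have r1 : models (update m0 (addr 1 0) k) s by exact: rel_update_reserved.
    set m := update m0 _ _ in r1 *.
    have mJ : m (addr 1 0) = k by rewrite /m update_addr.
    rewrite (models_eval_cell 0 _ r1) (evJ _ _ r1) mJ (eval_compile_exp r1 mJ he).
    split; first exact: rel_update_reserved.
      by rewrite update_addr.
    move=> i hi; rewrite update_addr //= /m update_addr //=.
    by case: eqP => [->//|ne]; apply: h3; lia.
  - move=> m b hb hm [m0 [h1 h2 h3] E].
    have r1 : models m s by rewrite E; exact: rel_update_reserved.
    have mJ : m (addr 1 0) = k by rewrite E update_addr.
    rewrite (eval_compile_exp r1 mJ he).
    (* Degree at most one enters here: the bit-length rises above b by at most [hgrowth e * b0]. *)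
    apply: (@leq_trans (2 ^ (hgrowth e * b0 + hdeg e * b))).
      apply: heval_bound => //; first exact: leq_trans hb.
        by move=> a' k' ha'; case: r1 => _ <- //; exact: hm.
      by rewrite -mJ; exact: hm.
    rewrite leq_exp2l // addnC leq_add //.
      by rewrite -{2}(mul1n b) leq_mul2r hdeg1 orbT.
    by apply: leq_trans hal; rewrite leq_mul2r leq_addl orbT.
(* In the second loop the entries from k on already hold their new values. *)
pose st k : store := fun b l => if (b == a) && (k <= l < N) then v l else s b l.
pose Inv k m := [/\ models m (st k), m (addr 1 0) = k & forall i, i < N -> m (addr 0 i) = v i].
apply: (triple_conseq (P := tmpInv s v N 0) (Q := Inv 0)) => //.
  by move=> m [h1 _ _]; apply: rel_ext h1 => b l; rewrite /st /tab /=.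
apply: (triple_for b0_gt0 (ad := addr 1 0)).
- by move: hga => /=; lia.
- by move: hga => /=; lia.
- move=> m [h h2 h3]; split; first exact: (models_eval_cell 1 (Const 0) h).
    exact: evP h.
  split; last 1 first.
  + by move=> i hi; rewrite update_addr //= h3.
  + apply: rel_update_reserved => //; apply: rel_ext h => b l.
    by rewrite /st (_ : (N <= l < N) = false) ?andbF //; lia.
  by rewrite update_addr.
- by move=> m b _ _ _; exact: nonly_bound.
- by move=> k m [h1 h2 h3]; split=> //; exact: (models_eval_cell 1 (Const 0) h1).
move=> k hk.
have main m0 : Inv k.+1 m0 -> let m := update m0 (addr 1 0) k in
    [/\ models m (st k.+1), m (addr 1 0) = k, eval m (cell a.+2 (Read c)) = addr a.+2 k,
       eval m (Read (cell 0 (Read c))) = v k & forall i, i < N -> m (addr 0 i) = v i].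
  move=> [h1 h2 h3] m.
  have r1 : models m (st k.+1) by exact: rel_update_reserved.
  have mJ : m (addr 1 0) = k by rewrite /m update_addr.
  have h4 i : i < N -> m (addr 0 i) = v i by move=> hi; rewrite /m update_addr //= h3.
  split=> //; first by rewrite (models_eval_cell _ _ r1) (evJ _ _ r1) mJ.
  have -> : eval m (Read (cell 0 (Read c))) = m (eval m (cell 0 (Read c))) by [].
  by rewrite (models_eval_cell _ _ r1) (evJ _ _ r1) mJ h4.
apply: triple_write => //.
- by move: hga => /=; lia.
- move=> _ [m0 /main [r1 mJ e1 e2 h4] ->]; rewrite e1 e2.
  split; last 1 first.
  + by move=> i hi; rewrite update_addr //= h4.
  + apply: rel_ext (rel_update k (v k) ha r1) => b l; rewrite /st.
    case: (b == a) => //=; case: (altP (l =P k)) => [->|ne]; first by rewrite leqnn hk.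
    by rewrite (_ : (k < l < N) = (k <= l < N)) //; lia.
  by rewrite update_addr.
- move=> m b hb hm [m0 hI E].
  have -> : eval m (Read (cell 0 (Read c))) = m (eval m (cell 0 (Read c))) by [].
  apply: (@leq_trans (2 ^ b)); first exact: hm.
  by rewrite leq_exp2l // leq_addr.
Qed.

Lemma compile_ok p s : well_formed p -> growth p * b0 <= al -> program_size (compile p) <= ga ->
  triple (models^~ s) (compile p) (step_poly p).[n]%R (models^~ (run p s)).
Proof.
elim: p s => [a P e|p1 IH1 p2 IH2|i P b IH] s; first exact: compile_tab.
  move=> /andP[w1 w2] /=; rewrite mulnDl => hal hga; rewrite hornerD.
  apply: triple_seq; first by apply: IH1 => //; lia.
  by apply: IH2 => //; lia.
move=> /and4P[hi hP hib hb] hal hga.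
have NE s' j : heval s' j P = heval s 0 P by rewrite !nonly_eval.
rewrite [run _ _]/=; set N := heval s 0 P in NE *.
have hPal : hgrowth P * b0 <= al by apply: leq_trans hal; rewrite leq_mul2r leq_addr orbT.
have -> : (step_poly (PIter i P b)).[n]%R = N * ((step_poly b).[n]%R + 2) + 2.
  by rewrite /= !hornerD !hornerM !hornerD !hornerC /N nonly_eval.
(* The invariant records that the k remaining iterations lead from [s'] to the final store. *)
pose Inv k m := m (addr i.+2 0) = k /\
  exists s', models m (set_counter i k s') /\ iter_down (run b) i N s = iter_down (run b) i k s'.
move: hga; rewrite [compile _]/= => hga.
have ec m s' : models m s' -> eval m (cell i.+2 (Const 0)) = addr i.+2 0.
  by move=> h; exact: (models_eval_cell i.+2 (Const 0) h).
have wi : i.+2 < width by [].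
apply: (triple_conseq (P := models^~ s) (Q := Inv 0)) => //.
  by move=> m [h [s' [h1 ->]]].
apply: (triple_for b0_gt0 (ad := addr i.+2 0)).
- by move: hga => /=; lia.
- by move: hga => /=; lia.
- move=> m h; split; first exact: ec h.
    rewrite (@eval_compile_exp w m s (m (addr 1 0))) ?nonly_hids //; exact: NE.
  split; first by rewrite update_addr // !eqxx.
  exists s; split=> //; exact: rel_update.
- by move=> m b' _ _ _; exact: nonly_bound.
- by move=> k m [h [s' [h1 h2]]]; split=> //; exact: ec h1.
move=> k hk m b' hb' hm [m0 [h0 [s' [h1 h2]]] E].
have r : models m (set_counter i k s').
  rewrite E; apply: rel_ext (rel_update 0 k hi h1) => a l.
  by rewrite /set_counter; case: (_ && _).
have h3 : growth b * b0 <= al by apply: leq_trans hal; rewrite /= leq_mul2r leq_addl orbT.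
have h4 : program_size (compile b) <= ga by move: hga => /=; lia.
have [t [m' [k1 k2 k3 k4]]] := IH (set_counter i k s') hb h3 h4 m b' hb' hm r.
exists t, m'; split=> //.
have e1 : run b (set_counter i k s') i 0 = k by rewrite frame // /set_counter !eqxx.
split; first by case: k3 => _ ->.
exists (run b (set_counter i k s')); split; last by rewrite h2.
by apply: rel_ext k3 => a l; rewrite {2}/set_counter; case: ifP => // /andP[/eqP-> /eqP->].
Qed.

(* Cells 0 and 1 come last: cell 0 holds the number of vertices, on which all
   array addresses depend. *)
Definition output_program mx den : program :=
  let J := Read (cell 1 (Const 0)) in
  let J1 := Add J (Const 1) in
  Seq (for_loop (cell 1 (Const 0)) (Defs.Sub (Mul (Read (Const 0)) (Read (Const 0))) (Const 1))
        (Seq (Write (Mul (Const 2) J1) (Read (cell mx.+2 J1)))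
             (Write (Add (Mul (Const 2) J1) (Const 1)) (compile_exp den))))
      (Seq (Write (Const 1) (compile_exp den)) (Write (Const 0) (Read (cell mx.+2 (Const 0))))).

Lemma nonly_bound_eval m den b : m 0 = n -> nonly den -> hgrowth den * b0 <= al ->
  eval m (compile_exp den) < 2 ^ (b + al).
Proof.
move=> m0 hden hal; have := nonly_bound (fun _ _ => 0) b hden hal.
by rewrite nonly_eval // -(@eval_compile_nonly w m).
Qed.

Lemma output_program_ok s mx den : mx.+2 < width -> nonly den -> hgrowth den * b0 <= al ->
  2 * b0 <= al -> program_size (output_program mx den) <= ga ->
  triple (models^~ s) (output_program mx den) ((n * n - 1) * (2 + 2) + 2 + 2)
    (fun m => forall k, k < n * n -> m (2 * k) = s mx k /\ m (2 * k).+1 = (hpoly den).[n]%R).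
Proof.
move=> hmx hden hal1 hal2 hga.
pose D := (hpoly den).[n]%R.
(* The output overwrites the input, so only cell 0 and the arrays are preserved. *)
pose base m := m 0 = n /\ (forall a l, a.+2 < width -> m (addr a.+2 l) = s a l).
pose done m k := forall i, k < i < n * n -> m (2 * i) = s mx i /\ m (2 * i).+1 = D.
pose Inv k m := [/\ base m, m (addr 1 0) = k & done m k].
have wd1 : 1 < width by [].
have evJ m : base m -> eval m (Read (cell 1 (Const 0))) = m (addr 1 0).
  by move=> h /=; have := eval_cell 1 (Const 0) (proj1 h) => /= ->.
have evmx m e : base m -> eval m (Read (cell mx.+2 e)) = s mx (eval m e).
  move=> [h h'] ; have -> : eval m (Read (cell mx.+2 e)) = m (eval m (cell mx.+2 e)) by [].
  by rewrite (eval_cell _ _ h) h'.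
have evden m : base m -> eval m (compile_exp den) = D by case=> h _; exact: eval_compile_nonly.
have addr_ge a l : X <= addr a l by exact: addr_geX.
have base_low m k v : base m -> 0 < k < X -> base (update m k v).
  move=> [h h'] hk; split; first by rewrite update_neq //; lia.
  move=> a l ha; rewrite update_neq ?h' //.
  by have := addr_ge a.+2 l; lia.
have J_low m k v : k < X -> update m k v (addr 1 0) = m (addr 1 0).
  by move=> hk; rewrite update_neq //; have := addr_ge 1 0; lia.
move: hga; rewrite /output_program; set J := Read (cell 1 (Const 0)); set J1 := Add J _ => hga.
have evJ1 m : base m -> eval m J1 = (m (addr 1 0)).+1.
  by move=> h; rewrite -addn1 -(evJ _ h).
apply: (triple_seq (Q := Inv 0)).
  apply: (triple_for b0_gt0 (ad := addr 1 0)).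
  - by move: hga => /=; lia.
  - by move: hga => /=; lia.
  - move=> m [h1 h2]; have m0 : m 0 = n by rewrite h1.
    split; [exact: eval_cell | by rewrite /= m0 | split].
    + split; last by move=> a l ha; rewrite update_addr // h2.
      by rewrite update_neq //; have := addr_ge 1 0; rewrite /X; lia.
    + by rewrite update_addr.
    + by move=> i; lia.
  - move=> m b hb hm [h1 _]; have m0 : n < 2 ^ b0 by exact: w_bound.
    apply: (@leq_ltn_trans (n * n)); first exact: leq_subr.
    apply: (@leq_trans (2 ^ (b0 + b0))); first by rewrite expnD ltn_mul.
    by rewrite leq_exp2l //; lia.
  - by move=> k m [h1 h2 h3]; split=> //; exact: (eval_cell _ _ (proj1 h1)).
  move=> k hk.
  pose Mid m := [/\ base m, m (addr 1 0) = k, done m k.+1 & m (2 * k.+1) = s mx k.+1].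
  apply: (@triple_seq _ _ _ _ _ 1 Mid _ 1).
    have main m : (exists2 m0, Inv k.+1 m0 & m = update m0 (addr 1 0) k) ->
      [/\ base m, m (addr 1 0) = k & done m k.+1].
      move=> [m0 [[h1 h2] h3 h4] ->]; split.
      - split; last by move=> a l ha; rewrite update_addr // h2.
        by rewrite update_neq //; have := addr_ge 1 0; rewrite /X; lia.
      - by rewrite update_addr.
      move=> i hi; rewrite !update_neq; first exact: h4.
        by have := addr_ge 1 0; rewrite /X; lia.
      by have := addr_ge 1 0; rewrite /X; lia.
    apply: triple_write => //; first by move: hga => /=; lia.
      move=> m /main [h1 h2 h3].
      have -> : eval m (Mul (Const 2) J1) = 2 * k.+1 by rewrite -h2 -(evJ1 _ h1).
      rewrite evmx // evJ1 // h2; split.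
      - by apply: base_low => //; rewrite /X; lia.
      - by rewrite J_low // /X; lia.
      - by move=> i hi; rewrite !update_neq; [exact: h3| |]; lia.
      by rewrite update_eq.
    move=> m b hb hm _.
    have -> : eval m (Read (cell mx.+2 J1)) = m (eval m (cell mx.+2 J1)) by [].
    by apply: leq_trans (hm _) _; rewrite leq_exp2l // leq_addr.
  apply: triple_write => //; first by move: hga => /=; lia.
    move=> m [h1 h2 h3 h4].
    have -> : eval m (Add (Mul (Const 2) J1) (Const 1)) = (2 * k.+1).+1.
      by rewrite -h2 -(evJ1 _ h1) -[RHS]addn1.
    rewrite evden //; split.
    - by apply: base_low => //; rewrite /X; lia.
    - by rewrite J_low // /X; lia.
    move=> i hi; case: (altP (i =P k.+1)) => [->|ne].
      by rewrite update_eq update_neq //; lia.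
    by rewrite !update_neq; [apply: h3 | |]; lia.
  by move=> m b hb hm [[h1 _] _ _ _]; exact: nonly_bound_eval.
apply: (@triple_seq _ _ _ _ _ 1 (fun m => [/\ base m, done m 0 & m 1 = D]) _ 1).
  apply: triple_write => //; first by move: hga => /=; lia.
    move=> m [h1 h2 h3]; rewrite evden //; split.
    - by apply: base_low => //; rewrite /X; lia.
    - by move=> i hi; rewrite !update_neq; [exact: h3| |] => /=; lia.
    by rewrite update_eq.
  by move=> m b hb hm [[h1 _] _ _]; exact: nonly_bound_eval.
apply: triple_write => //; first by move: hga => /=; lia.
  move=> m [h1 h2 h3] k hk; rewrite evmx //; case: k hk => [|k] hk; first by rewrite update_eq update_neq.
  by rewrite !update_neq; [apply: h2 | |]; rewrite /=; lia.
move=> m b hb hm _.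
have -> : eval m (Read (cell mx.+2 (Const 0))) = m (eval m (cell mx.+2 (Const 0))) by [].
by apply: leq_trans (hm _) _; rewrite leq_exp2l // leq_addr.
Qed.

End Compile.

(** * Polynomial running time of compiled programs *)

Lemma horner_nat_mono (P : {poly nat}) a b : a <= b -> (P.[a] <= P.[b])%N%R.
Proof.
move=> h; rewrite !horner_coef; elim: (size P) => [|k IH]; first by rewrite !big_ord0.
rewrite !big_ord_recr /= leq_add // leq_mul2l.
by apply/orP; right; elim: (k) => [|i IHi] //; rewrite !GRing.exprS leq_mul.
Qed.

(* Writes of degree at most one in the memory contents add O(word size) bits
   each, so running time is polynomial without any bound on stored values. *)
Theorem run_polytime p mx den : well_formed p -> mx.+2 < width -> nonly den ->
  exists (A : program) (T : {poly nat}), forall w : seq nat,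
    let n := nth 0 w 0 in size w = 2 + 2 * (n * n) ->
    exists t m, [/\ exec A (input_memory w) t m, t <= T.[word_size w]%R
      & forall k, k < n * n ->
          m (2 * k) = run w p (fun _ _ => 0) mx k /\ m (2 * k).+1 = (hpoly den).[n]%R].
Proof.
move=> hp hmx hden.
pose A := Seq (compile p) (output_program mx den).
(* The 2 accounts for the product n * n that bounds the output loop. *)
pose a0 := growth p + hgrowth den + 2.
pose NP : {poly nat} := (step_poly p + ('X * 'X * 4%:P + 4%:P))%R.
pose T : {poly nat} := (NP * ((program_size A)%:P * (('X + 1%:P) + (a0%:P * ('X + 1%:P)) * NP)))%R.
exists A, T => w n hw.
set ws := word_size w; pose b0 := ws + 1.
have b0_gt0 : 0 < b0 by rewrite /b0 addn1.
have hws : size w <= ws.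
  by rewrite /ws /word_size -sum1_size leq_sum.
have w_bound k : nth 0 w k < 2 ^ b0.
  case: (ltnP k (size w)) => hk; last by rewrite nth_default // expn_gt0.
  apply: (@leq_trans (2 ^ bits (nth 0 w k))); first exact: trunc_log_ltn.
  rewrite leq_exp2l // /b0 /ws /word_size (big_nth 0) big_mkord (bigD1 (Ordinal hk)) //=; lia.
pose al := a0 * b0; pose ga := program_size A.
have hA : program_size A = program_size (compile p) + program_size (output_program mx den) by [].
have hle c : c <= a0 -> c * b0 <= al by rewrite /al leq_mul2r => ->; rewrite orbT.
have t1 : triple al ga b0 (models w ^~ (fun _ _ => 0)) (compile p) (step_poly p).[n]%R
     (models w ^~ (run w p (fun _ _ => 0))).
  apply: compile_ok => //; first by apply: hle; rewrite /a0; lia.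
  by rewrite /ga hA leq_addr.
have hA2 : program_size (output_program mx den) <= ga by rewrite /ga hA leq_addl.
have hle1 : hgrowth den * b0 <= al by apply: hle; rewrite /a0; lia.
have hle2 : 2 * b0 <= al by apply: hle; rewrite /a0; lia.
have t2 := output_program_ok b0_gt0 w_bound hmx hden hle1 hle2 hA2 (s := run w p (fun _ _ => 0)).
have [||t [m [h1 h2 h3 h4]]] := triple_seq t1 t2 (leqnn b0) (m := input_memory w).
- by move=> k; exact: w_bound.
- split=> // a k ha; rewrite /input_memory nth_default // hw.
  by rewrite /addr -/n; lia.
exists t, m; split=> //.
apply: leq_trans h4 _.
set N := _ + _.
have hN : N <= NP.[ws]%R.
  (* The input has 2 + 2 n^2 cells of at least one bit each, so n is at most the word size. *)
  apply: (@leq_trans NP.[n]%R); last first.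
    apply: horner_nat_mono; apply: leq_trans hws; rewrite hw.
    by case: (n) => // n'; rewrite mulSn; lia.
  rewrite /N /NP !hornerD !hornerM !hornerC !hornerX leq_add2l.
  suff: (n * n - 1) * (2 + 2) + 2 + 2 <= n * n * 4 + 4 by [].
  lia.
rewrite /T; move: (NP) hN => NP' hN.
rewrite !hornerM !hornerD !hornerM !hornerD !hornerC !hornerX.
apply: (@leq_mul N) => //; apply: (leq_mul (leqnn _)); rewrite -[(ws + 1)%R]/b0.
apply: leq_add => //; rewrite -[(a0 * b0)%R]/al; exact: (leq_mul (leqnn _) hN).
Qed.

(** * The program *)

(** Tests are truncated differences from the constant 1, hence of degree 0 in the memory; a
    conditional thus has only the degree of its branches, as [well_formed] demands. *)
Definition hsg a := HSub (HC 1) (HSub (HC 1) a).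
Definition hite c a b := HAdd (HMul (hsg c) a) (HMul (HSub (HC 1) c) b).
Definition heq a b := HSub (HC 1) (HAdd (HSub a b) (HSub b a)).
Definition hle a b := HSub (HC 1) (HSub a b).
Definition hlt a b := hsg (HSub b a).
Definition hmod a b := HSub a (HMul (HDiv a b) b).
Definition hmin a b := HSub a (HSub a b).
Definition hmax a b := HAdd a (HSub b a).
Definition hand a b := HMul (hsg a) (hsg b).

Section Macros.
Variables (w : seq nat) (s : store) (j : nat).
Notation ev := (heval w s j).

Lemma heval_HC c : ev (HC c) = c. Proof. by []. Qed.
Lemma heval_HN : ev HN = nth 0 w 0. Proof. by []. Qed.
Lemma heval_HJ : ev HJ = j. Proof. by []. Qed.
Lemma heval_HG a e : ev (HG a e) = s a (ev e). Proof. by []. Qed.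
Lemma heval_HAdd a b : ev (HAdd a b) = ev a + ev b. Proof. by []. Qed.
Lemma heval_HMul a b : ev (HMul a b) = ev a * ev b. Proof. by []. Qed.
Lemma heval_HSub a b : ev (HSub a b) = ev a - ev b. Proof. by []. Qed.
Lemma heval_HDiv a b : ev (HDiv a b) = ev a %/ ev b. Proof. by []. Qed.
Lemma heval_hsg a : ev (hsg a) = (ev a != 0).
Proof. by rewrite /hsg /=; case: (ev a) => // k; lia. Qed.
Lemma heval_hite c a b : ev (hite c a b) = if ev c != 0 then ev a else ev b.
Proof.
rewrite /hite heval_HAdd !heval_HMul heval_hsg heval_HSub heval_HC.
by case: (ev c) => [|k]; rewrite /= ?mul1n ?mul0n ?addn0 // subSS sub0n mul0n addn0.
Qed.
Lemma heval_heq a b : ev (heq a b) = (ev a == ev b).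
Proof. by rewrite /heq /=; case: eqP => h; lia. Qed.
Lemma heval_hle a b : ev (hle a b) = (ev a <= ev b).
Proof. by rewrite /hle /=; case: leqP => h; lia. Qed.
Lemma heval_hlt a b : ev (hlt a b) = (ev a < ev b).
Proof. by rewrite /hlt heval_hsg heval_HSub -lt0n subn_gt0. Qed.
Lemma heval_hmod a b : ev (hmod a b) = ev a %% ev b.
Proof. by rewrite /hmod !(heval_HSub, heval_HMul, heval_HDiv) {1}(divn_eq (ev a) (ev b)) addKn. Qed.
Lemma heval_hmin a b : ev (hmin a b) = minn (ev a) (ev b).
Proof. by rewrite /hmin /=; lia. Qed.
Lemma heval_hmax a b : ev (hmax a b) = maxn (ev a) (ev b).
Proof. by rewrite /hmax /=; lia. Qed.
Lemma heval_hand a b : ev (hand a b) = (ev a != 0) && (ev b != 0).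
Proof. by rewrite /hand heval_HMul !heval_hsg mulnb. Qed.

Definition hevalE := (heval_hite, heval_heq, heval_hle, heval_hlt, heval_hmod, heval_hmin,
  heval_hmax, heval_hand, heval_hsg, heval_HAdd, heval_HMul, heval_HSub, heval_HDiv,
  heval_HC, heval_HN, heval_HJ, heval_HG, eqb0, negbK).
End Macros.

Lemma run_tabE w a P e s k : k < heval w s 0 P -> run w (PTab a P e) s a k = heval w s k e.
Proof. by move=> hk; rewrite /= /tab eqxx hk. Qed.

Lemma run_seq w p1 p2 s : run w (PSeq p1 p2) s = run w p2 (run w p1 s).
Proof. by []. Qed.

(** Counters run down, so [Inv k] speaks of k iterations left. The step may also use that arrays not
    written by the body keep their initial contents. *)
Lemma iter_ind w (Inv : nat -> store -> Prop) i P b s :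
  i \notin writes b ->
  Inv (heval w s 0 P) s ->
  (forall k x s', Inv k s' -> Inv k (set_counter i x s')) ->
  (forall k s', k < heval w s 0 P -> s' i 0 = k ->
     (forall a, a \notin i :: writes b -> forall l, s' a l = s a l) ->
     Inv k.+1 s' -> Inv k (run w b s')) ->
  Inv 0 (run w (PIter i P b) s).
Proof.
move=> hi h0 hset hstep.
rewrite [run _ _ _]/=; set N := heval _ _ _ _ in h0 hstep *.
suff main N' s' : N' <= N -> Inv N' s' ->
    (forall a, a \notin i :: writes b -> forall l, s' a l = s a l) ->
    Inv 0 (iter_down (run w b) i N' s') by exact: main.
elim: N' s' => [|k IH] s' hk hs' hfr; first exact: hset.
have hfr' a : a \notin i :: writes b -> forall l, set_counter i k s' a l = s a l.
  move=> ha l; rewrite -hfr // /set_counter ifF //.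
  by move: ha; rewrite inE negb_or => /andP[/negbTE ->].
apply: IH; first exact: ltnW.
  by apply: hstep => //; [rewrite /set_counter !eqxx | exact: hset].
move=> a ha l; rewrite frame ?hfr' //.
by move: ha; rewrite inE negb_or => /andP[].
Qed.

Local Notation aDL := 0 (only parsing). (* closure distances *)
Local Notation aW := 1 (only parsing). (* weights W(d,e) *)
Local Notation aC := 2 (only parsing). (* counts C(d,e) *)
Local Notation aT := 3 (only parsing). (* edge costs of the current round *)
Local Notation aS := 4 (only parsing). (* S_e = sum_d W(d,e) *)
Local Notation aD0 := 5 (only parsing). (* costs of the cheapest walks, last hop *)
Local Notation aD1 := 6 (only parsing). (* the same, current hop *)
Local Notation aQ0 := 7 (only parsing). (* edge sets of these walks, last hop *)
Local Notation aQ1 := 8 (only parsing). (* the same, current hop *)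
Local Notation aDQ := 9 (only parsing). (* edges used in this round *)
Local Notation aMX := 10 (only parsing). (* max_d C(d,e) *)
Local Notation iR := 11 (only parsing).
Local Notation iD := 12 (only parsing).
Local Notation iH := 13 (only parsing).
Local Notation iU := 14 (only parsing).
Local Notation iX := 15 (only parsing).
Local Notation iY := 16 (only parsing).

(** * The algorithm: distances, cheapest walks, weights and rounds *)

Section Program.
Variables (K : nat) (hq : hexp).

Definition n2 := HMul HN HN.
Definition n4 := HMul n2 n2.
(* A simple closure path has length at most n * (n * q(n)), so the budgets
   0, ..., n^2 q(n) suffice; [hLam] also stands for an infinite distance. *)
Definition hLam := HAdd (HMul n2 hq) (HC 1).
Definition hM := HMul (HC K) n2.
(* Exceeds the cost of every walk with at most n steps. *)
Definition hinf := HAdd (HMul HN (HAdd hM (HC 1))) (HC 1).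
Definition ctr i := HG i (HC 0).
Definition hlen e := HI (HAdd (HC 2) e).
Definition hdem d := HI (HAdd (HAdd (HC 2) n2) d).

Definition p_dstep : prog :=
  PTab aDL n2 (hmin (HG aDL HJ)
    (HAdd (HG aDL (HAdd (HMul (HDiv HJ HN) HN) (ctr iY)))
          (HG aDL (HAdd (HMul (ctr iY) HN) (hmod HJ HN))))).

(** A sweep tries all intermediate vertices, as in Floyd-Warshall. With n sweeps, each one has to
    account for a single further edge only, as in Bellman-Ford. *)
Definition p_dist : prog :=
  PSeq (PTab aDL n2 (hite (heq (HDiv HJ HN) (hmod HJ HN)) (HC 0)
                      (hite (hlen HJ) (hlen HJ) hLam)))
       (PIter iX HN (PIter iY HN p_dstep)).

Definition nD := HMul (HMul n2 hLam) HN.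
Definition nQ := HMul nD n2.
Definition jv j := hmod j HN.
Definition jL j := hmod (HDiv j HN) hLam.
Definition jd j := HDiv (HDiv j HN) hLam.
(** A state of the dynamic program in mixed radix: demand, length budget, end vertex. *)
Definition hstate d L v := HAdd (HMul (HAdd (HMul d hLam) L) HN) v.
Definition jUV j := HAdd (HMul (ctr iU) HN) (jv j).
Definition src j := hstate (jd j) (HSub (jL j) (HG aDL (jUV j))) (ctr iU).
Definition cand j := HAdd (HG aD0 (src j)) (HG aT (HAdd (HMul (jd j) n2) (jUV j))).
(* The test on [iH] makes exactly min(n, hopbound) of the n sweeps effective. *)
Definition cond j :=
  hand (hand (hlt (ctr iH) (HI (HC 1))) (hle (HG aDL (jUV j)) (jL j)))
       (hlt (cand j) (HG aD1 j)).

(** Extends walks by a step from [iU]. Edge sets are updated before costs, because both tests refer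
    to the old costs in [aD1]. *)
Definition p_relax : prog :=
  PSeq (PTab aQ1 nQ (hite (cond (HDiv HJ n2))
          (hite (heq (hmod HJ n2) (jUV (HDiv HJ n2))) (HC 1)
             (HG aQ0 (HAdd (HMul (src (HDiv HJ n2)) n2) (hmod HJ n2))))
          (HG aQ1 HJ)))
       (PTab aD1 nD (hite (cond HJ) (cand HJ) (HG aD1 HJ))).

(** Separate arrays for the last and the current hop keep the loop over [iU] from adding more than
    one step. *)
Definition p_hop : prog :=
  PSeq (PTab aD1 nD (HG aD0 HJ)) (PSeq (PTab aQ1 nQ (HG aQ0 HJ))
  (PSeq (PIter iU HN p_relax)
  (PSeq (PTab aD0 nD (HG aD1 HJ)) (PTab aQ0 nQ (HG aQ1 HJ))))).

Definition p_dp : prog :=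
  PSeq (PTab aD0 nD (hite (heq (jv HJ) (HDiv (jd HJ) HN)) (HC 0) hinf))
  (PSeq (PTab aQ0 nQ (HC 0)) (PIter iH HN p_hop)).

Definition p_weights : prog :=
  PSeq (PTab aS n2 (HC 0))
  (PSeq (PIter iD n2 (PTab aS n2 (HAdd (HG aS HJ) (HG aW (HAdd (HMul (ctr iD) n2) HJ)))))
  (PTab aT n4 (hite (hlen (hmod HJ n2)) (HC 0)
     (HAdd (HDiv (HMul hM (HG aW HJ)) (HG aS (hmod HJ n2))) (HC 1))))).

Definition p_update : prog :=
  PSeq (PTab aDQ n4 (hand (hdem (HDiv HJ n2))
     (HG aQ0 (HAdd (HMul (hstate (HDiv HJ n2)
          (hmin (HSub (hdem (HDiv HJ n2)) (HC 1)) (HMul n2 hq))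
          (hmod (HDiv HJ n2) HN)) n2) (hmod HJ n2)))))
  (PSeq (PTab aW n4 (HMul (HG aW HJ) (HAdd (HC K) (hsg (HG aDQ HJ)))))
        (PTab aC n4 (HAdd (HG aC HJ) (hsg (HG aDQ HJ))))).

(** With this number of rounds the additive error n^4 contributes only 1/K to the objective. It is
    also the common denominator of the output. *)
Definition hT := HMul (HMul (HC K) (HC K.+1)) n4.

Definition p_main : prog :=
  PSeq p_dist
  (PSeq (PTab aW n4 (HC 1))
  (PSeq (PIter iR hT (PSeq p_weights (PSeq p_dp p_update)))
        (PIter iD n2 (PTab aMX n2 (hmax (HG aMX HJ) (HG aC (HAdd (HMul (ctr iD) n2) HJ))))))).

Lemma well_formed_main : nonly hq -> well_formed p_main.
Proof.
move=> hqn; have hh := nonly_hids hqn; have hd0 := nonly_degb hqn.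
by rewrite /= hqn hh hd0.
Qed.

End Program.

(** * Walks and multiplicative weights *)

(** Cuts out a loop: the rest of a walk from a visited vertex on consists of steps of the walk. *)
Lemma suffix_walk (T : eqType) (e : rel T) x y q : path e y q -> x \in y :: q ->
  exists q', [/\ path e x q', last x q' = last y q, subseq (x :: q') (y :: q)
               & subseq (steps x q') (steps y q)].
Proof.
elim: q y => [|z q IH] y.
  by rewrite inE => _ /eqP->; exists [::]; split=> //=; rewrite eqxx.
move=> /[dup] hp /andP[yz zq]; rewrite inE => /orP[/eqP->|xq].
  by exists (z :: q); split=> //; exact: subseq_refl.
have [q' [h1 h2 h3 h4]] := IH z zq xq; exists q'; split=> //.
  by apply: subseq_trans h3 _; exact: subseq_cons.
by apply: subseq_trans h4 _; exact: subseq_cons.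
Qed.

(* [shorten] would not do: its specification relates the vertices of the two
   walks, not their steps. *)
Lemma simple_walk (T : eqType) (e : rel T) u p : path e u p ->
  exists p', [/\ path e u p', last u p' = last u p, uniq (u :: p')
               & subseq (steps u p') (steps u p)].
Proof.
elim: p u => [|v p IH] u; first by exists [::].
case/andP=> uv vp; have [p' [h1 h2 h3 h4]] := IH v vp.
case: (boolP (u \in v :: p')) => hu; last first.
  by exists (v :: p'); split=> //=; rewrite ?uv ?hu //= /steps /= eqxx.
have [q [k1 k2 k3 k4]] := suffix_walk h1 hu.
exists q; split=> //.
- by rewrite k2 h2.
- exact: subseq_uniq k3 h3.
- apply: subseq_trans k4 _; apply: subseq_trans h4 _; exact: subseq_cons.
Qed.

Lemma size_steps (T : Type) (u : T) p : size (steps u p) = size p.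
Proof. by rewrite size_zip /=; lia. Qed.

Lemma map_fst_steps (T : Type) (u : T) p : [seq x.1 | x <- steps u p] = belast u p.
Proof. by elim: p u => //= v p IH u; rewrite -IH. Qed.

Lemma uniq_steps (T : eqType) (u : T) p : uniq (u :: p) -> uniq (steps u p).
Proof.
rewrite lastI rcons_uniq => /andP[_]; rewrite -map_fst_steps; exact: map_uniq.
Qed.

Lemma leq_sum_subseq (T : eqType) (f : T -> nat) s s' : subseq s s' ->
  \sum_(x <- s) f x <= \sum_(x <- s') f x.
Proof.
elim: s' s => [|y s' IH] [|x s] //=; rewrite ?big_nil //.
case: eqP => [->|_] /IH h; rewrite !big_cons ?leq_add2l //.
by apply: leq_trans (leq_addl _ _); rewrite big_cons in h.
Qed.

Lemma path_steps (T : eqType) (e : rel T) u p x : path e u p -> x \in steps u p -> e x.1 x.2.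
Proof.
elim: p u => [|v p IH] u //= /andP[uv vp]; rewrite inE => /orP[/eqP->//|].
exact: IH.
Qed.

Section Closure.
Variable I : instance.
Implicit Types (d e : pair_of I).

(** As [valid_path] without simplicity, which the dynamic program does not enforce. *)
Definition valid_walk d (p : seq 'I_(nb_vertices I)) : Prop :=
  [/\ path (@closure_rel I) d.1 p, last d.1 p = d.2, size p <= hopbound I
    & \sum_(e <- steps d.1 p) dist e.1 e.2 <= Dist d].

Lemma valid_walk_path d p : valid_walk d p ->
  exists2 p', valid_path d p' & subseq (steps d.1 p') (steps d.1 p).
Proof.
case=> h1 h2 h3 h4; have [p' [k1 k2 k3 k4]] := simple_walk h1.
exists p' => //; split=> //; first by rewrite k2.
  by apply: leq_trans h3; rewrite -(size_steps d.1 p') -(size_steps d.1 p); exact: size_subseq.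
by apply: leq_trans h4; exact: leq_sum_subseq.
Qed.

Lemma step_closure u p e : path (@closure_rel I) u p -> e \in steps u p -> e \in closure_edge I.
Proof. by move=> h /(path_steps h); rewrite /closure_rel -surjective_pairing. Qed.

End Closure.

Local Open Scope ring_scope.

(** * Multiplicative weights for LP(Hopset) *)

Section MWU.
Variables (R : realType) (I : instance) (K : nat).
Hypothesis K_gt0 : (0 < K)%N.
Local Notation pair := (pair_of I).
Let n := nb_vertices I.
Let M := (K * (n * n))%N.

Section WeakDuality.
Variables (x0 : pair -> R) (d : pair).
Hypotheses (x0_feas : LP_feasible x0) (hd : d \in demand I).

(** Without valid paths the zero vector would be a cut vector, and its constraint would read 1 <=
    0. *)
Lemma feasible_valid_path : exists p, valid_path d p.
Proof.
apply: contrapT => hno; case: x0_feas => h _.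
have hc : cut_vector d (fun _ : pair => 0 : R).
  split; first by move=> e _; rewrite lexx ler01.
  by move=> p hp; case: hno; exists p.
by have := h d hd _ hc; rewrite big1 ?ler10 // => e _; rewrite mul0r.
Qed.

(* If [l > 0], the vector [min (1, c / l)] is a cut vector. *)
Lemma weak_duality (c : pair -> R) (l : R) : (forall e, 0 <= c e) ->
  (forall p, valid_path d p -> l <= \sum_(e <- steps d.1 p) c e) ->
  l <= \sum_(e in closure_edge I) c e * x0 e.
Proof.
move=> c0 hl; have [hx hx0] := x0_feas.
have s0 : 0 <= \sum_(e in closure_edge I) c e * x0 e.
  by apply: sumr_ge0 => e he; rewrite mulr_ge0 ?hx0.
case: (lerP l 0) => [/le_trans-> //|l0].
pose z e := Num.min 1 (c e / l).
have z0 e : 0 <= z e by rewrite /z le_min ler01 divr_ge0 // ltW.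
have hz : cut_vector d z.
  split; first by move=> e _; rewrite z0 /z ge_min lexx.
  (* Either one step costs at least l and alone contributes 1, or nothing is truncated along the
     path. *)
  move=> p hp; case: (boolP (has (fun e => l <= c e) (steps d.1 p))) => [/hasP[e he hle]|/hasPn hno].
    rewrite (big_rem e) //=.
    have -> : z e = 1 by rewrite /z min_l // ler_pdivlMr // mul1r.
    by rewrite lerDl sumr_ge0.
  rewrite big_seq (eq_bigr (fun e => c e / l)); last first.
    move=> e he; rewrite /z min_r // ler_pdivrMr // mul1r.
    by have := hno e he; rewrite -ltNge; exact: ltW.
  by rewrite -big_seq -mulr_suml ler_pdivlMr // mul1r hl.
have := hx d hd z hz.
rewrite -(ler_pM2l l0) mulr1 => h; apply: le_trans h _.
rewrite mulr_sumr; apply: ler_sum => e he; rewrite mulrA ler_wpM2r ?hx0 //.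
rewrite /z -[leRHS](divfK (lt0r_neq0 l0)) mulrC ler_wpM2r ?(ltW l0) //.
by rewrite ge_min lexx orbT.
Qed.

End WeakDuality.

Section Round.
Variables (W : pair -> pair -> nat).
Definition Stot e := (\sum_d W d e)%N.
(* Rounding up keeps the cost of new edges positive, so that walks of cost zero
   use old edges only. *)
Definition wt (d e : pair) : nat := if e \in edge I then 0%N else (M * W d e %/ Stot e + 1)%N.

(** What a round has to deliver. Containing a valid walk makes the edge set cover the demand; its
    cost is compared with simple valid paths, as weak duality requires. *)
Record good (Q : pair -> pair -> bool) : Prop := Good {
  good_walk : forall d, d \in demand I ->
    exists2 p, valid_walk d p & forall e, e \in steps d.1 p -> Q d e;
  good_min : forall d p, d \in demand I -> valid_path d p ->
    (\sum_(e | Q d e) wt d e <= \sum_(e <- steps d.1 p) wt d e)%N;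
  good_demand : forall d e, Q d e -> d \in demand I
}.
End Round.

(** The invariant after t rounds. The first field is W = (K+1)^C K^(t-C) without the subtraction;
    the last one handles objective values below 1, where the additive error could not be
    absorbed. *)
Record mwu (t : nat) (W C : pair -> pair -> nat) : Prop := Mwu {
  mwu_weight : forall d e, (W d e * K ^ C d e = K.+1 ^ C d e * K ^ t)%N;
  mwu_cover : forall d, d \in demand I -> forall z : pair -> R, cut_vector d z ->
    t%:R <= \sum_(e in closure_edge I) z e * (C d e)%:R;
  mwu_potential : forall x0 : pair -> R, LP_feasible x0 ->
    \prod_(e in new_edge I) ((Stot W e)%:R / (K ^ t)%:R) <=
    expR ((n * n * (n * n))%:R + t%:R * ((1 + K%:R^-1) * LP_objective x0) / K%:R);
  mwu_zero : forall x0 : pair -> R, LP_feasible x0 -> LP_objective x0 < 1 ->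
    forall d e, e \in new_edge I -> C d e = 0%N
}.

Let K0 : (0 : R) < K%:R. Proof. by rewrite ltr0n. Qed.

Lemma card_pair : #|{: pair}| = (n * n)%N.
Proof. by rewrite card_prod card_ord. Qed.

Lemma pair_n_gt0 (e : pair) : (0 < n * n)%N.
Proof. by rewrite -card_pair; apply/card_gt0P; exists e. Qed.

Lemma mwu_init : mwu 0 (fun _ _ => 1%N) (fun _ _ => 0%N).
Proof.
split=> //.
- by move=> d hd z [hz _]; apply: sumr_ge0 => e he; rewrite mulr0.
- move=> x0 _; rewrite mul0r mul0r addr0.
  (* Initially S_e = n^2 <= exp (n^2), and there are at most n^2 new edges. *)
  apply: (@le_trans _ _ (\prod_(e in new_edge I) expR ((n * n)%:R : R))).
    apply: ler_prod => e _; rewrite /Stot sum1_card card_pair expn0 divr1 ler0n /=.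
    by apply: le_trans (expR_ge1Dx _); rewrite lerDr.
  rewrite -expR_sum ler_expR sumr_const -mulrnA ler_nat leq_mul2l.
  by rewrite -[leqRHS]card_pair max_card orbT.
Qed.

Lemma mwu_weight_gt0 t W C : mwu t W C -> forall d e, (0 < W d e)%N.
Proof.
move=> h d e; have := mwu_weight h d e; case: (W d e) => // /esym/eqP.
by rewrite mul0n muln_eq0 !expn_eq0 /=; case: (K) K_gt0.
Qed.

Lemma Stot_gt0 W (d e : pair) : (forall d e, (0 < W d e)%N) -> (0 < Stot W e)%N.
Proof. by move=> h; rewrite /Stot (bigD1 d) //= addn_gt0 h. Qed.

Section Step.
Variables (t : nat) (W C : pair -> pair -> nat) (Q : pair -> pair -> bool).
Hypotheses (hI : mwu t W C) (hQ : good W Q).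
Let W' d e := (W d e * (K + Q d e))%N.
Let C' d e := (C d e + Q d e)%N.
Let Wgt0 := mwu_weight_gt0 hI.

(** The walk contains a simple valid path; its steps are distinct closure edges marked by [Q], and z
    sums to at least 1 over them. *)
Lemma closure_cover d (z : pair -> R) : d \in demand I -> cut_vector d z ->
  1 <= \sum_(e in closure_edge I) z e * (Q d e)%:R.
Proof.
move=> hd [hz hz1]; have [p hp hpQ] := good_walk hQ hd.
have [p' hp' hs] := valid_walk_path hp.
apply: le_trans (hz1 p' hp') _.
case: hp' => h1 _ h2 _ _.
rewrite big_uniq ?uniq_steps // big_mkcond [leRHS]big_mkcond; apply: ler_sum => e _.
case: (boolP (e \in steps d.1 p')) => he.
  rewrite (step_closure h1 he) (hpQ e) ?mulr1 //; exact: (mem_subseq hs).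
by case: ifP => // /hz /andP[z0 _]; rewrite mulr_ge0.
Qed.

(** The left side, divided by K, bounds the growth of the logarithm of the potential. Multiplied by
    M it is at most the total cost of the chosen sets, which weak duality bounds by the sum of
    [wt W d e * x0 e] over demands and new edges. For each new edge the costs sum over the demands
    to at most M, plus n^2 from rounding up, and M + n^2 = (1 + 1/K) M. *)
Lemma gain_bound (x0 : pair -> R) : LP_feasible x0 ->
  \sum_(e in new_edge I) ((\sum_d W d e * Q d e)%N%:R / (Stot W e)%:R)
    <= (1 + K%:R^-1) * LP_objective x0.
Proof.
move=> hx0; have [_ x00] := hx0.
case: (boolP [exists e : pair, true]) => [/existsP[e0 _]|/existsPn hno]; last first.
  by rewrite /LP_objective !big1 ?mulr0 // => e; case: (hno e).
have M0 : (0 : R) < M%:R by rewrite ltr0n muln_gt0 K_gt0 (pair_n_gt0 e0).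
have S0 e : (0 : R) < (Stot W e)%:R by rewrite ltr0n (Stot_gt0 e0).
have -> : (1 + K%:R^-1) * LP_objective x0 = (M%:R)^-1 * ((M + n * n)%:R * LP_objective x0).
  rewrite mulrA; congr (_ * _); rewrite natrD mulrDr mulVf ?lt0r_neq0 //; congr (_ + _).
  rewrite /M natrM invfM -mulrA mulVf ?mulr1 // lt0r_neq0 //.
  by rewrite ltr0n (pair_n_gt0 e0).
rewrite ler_pdivlMl // mulr_sumr.
have hnew e : e \in new_edge I -> e \in edge I = false.
  by rewrite inE => /andP[/negbTE].
have hcl e : e \in new_edge I -> e \in closure_edge I by rewrite inE => /andP[].
have hwt d e : e \in new_edge I -> M%:R * (W d e)%:R / (Stot W e)%:R <= (wt W d e)%:R :> R.
  move=> he; rewrite /wt hnew // ler_pdivrMr // -!natrM ler_nat.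
  have hS : (0 < Stot W e)%N by rewrite (Stot_gt0 e0).
  by rewrite addn1 ltnW // ltn_ceil.
apply: (@le_trans _ _ (\sum_(d in demand I) (\sum_(e | Q d e) wt W d e)%:R)).
  rewrite (eq_bigr (fun e => \sum_d (M%:R * (W d e)%:R / (Stot W e)%:R * (Q d e)%:R : R))); last first.
    move=> e _; rewrite natr_sum mulr_suml mulr_sumr; apply: eq_bigr => d _.
    by rewrite natrM -!mulrA [_^-1 * _]mulrC.
  rewrite exchange_big /= [leRHS]big_mkcond; apply: ler_sum => d _.
  case: ifP => hd; last first.
    rewrite big1 // => e _; case hq : (Q d e); last by rewrite mulr0.
    by rewrite (good_demand hQ hq) in hd.
  rewrite natr_sum big_mkcond [leRHS]big_mkcond; apply: ler_sum => e _.
  case: ifP => he; case: ifP => hq; rewrite ?mulr1 ?mulr0 //.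
  exact: hwt.
apply: (@le_trans _ _ (\sum_(d in demand I) \sum_(e in new_edge I) (wt W d e)%:R * x0 e)).
  apply: ler_sum => d hd.
  apply: le_trans (weak_duality hx0 hd (c := fun e => (wt W d e)%:R) _ _) _ => //.
    by move=> p hp; rewrite -natr_sum ler_nat; exact: (good_min hQ).
  rewrite big_mkcond [leRHS]big_mkcond; apply: ler_sum => e _.
  rewrite /new_edge !inE; case: ifP; rewrite ?andbF ?andbT // => _.
  by rewrite /wt; case: (e \in edge I); rewrite /= ?mul0r.
rewrite exchange_big /= /LP_objective mulr_sumr; apply: ler_sum => e he.
rewrite -mulr_suml ler_wpM2r ?x00 ?hcl // -natr_sum ler_nat.
rewrite /wt hnew //.
apply: (@leq_trans (\sum_d (M * W d e %/ Stot W e + 1))%N).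
  by rewrite [leqRHS](bigID (mem (demand I))) /= leq_addr.
rewrite big_split /= sum1_card card_pair leq_add2r.
have hS : (0 < Stot W e)%N by rewrite (Stot_gt0 e0).
rewrite -(leq_pmul2r hS) [leqLHS]big_distrl /=.
rewrite [in leqRHS]/Stot big_distrr /=.
by apply: leq_sum => d _; exact: leq_divM.
Qed.

Lemma mwu_step : mwu t.+1 W' C'.
Proof.
split.
- move=> d e; rewrite /W' /C'; have := mwu_weight hI d e.
  case: (Q d e) => /=; rewrite ?addn0 ?addn1 !expnS; first by nia.
  by nia.
- move=> d hd z hz; rewrite -addn1 natrD.
  under eq_bigr do rewrite /C' natrD mulrDr.
  by rewrite big_split /= lerD ?(mwu_cover hI) ?closure_cover.
- move=> x0 hx0.
  have E : expR ((n * n * (n * n))%:R + t.+1%:R * ((1 + K%:R^-1) * LP_objective x0) / K%:R) =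
     expR ((n * n * (n * n))%:R + t%:R * ((1 + K%:R^-1) * LP_objective x0) / K%:R) *
     expR ((1 + K%:R^-1) * LP_objective x0 / K%:R).
    by rewrite -expRD -[t.+1]addn1 natrD; congr expR; rewrite mulrDl mul1r mulrDl addrA.
  rewrite E.
  (* Each factor is multiplied by 1 + G / (S_e K), which is at most the exponential of G / (S_e
     K). *)
  apply: (@le_trans _ _ (\prod_(e in new_edge I) ((Stot W e)%:R / (K ^ t)%:R *
      expR ((\sum_d W d e * Q d e)%N%:R / (Stot W e)%:R / K%:R)))).
    apply: ler_prod => e he.
    rewrite divr_ge0 //=.
    have S0 : (0 : R) < (Stot W e)%:R by rewrite ltr0n (Stot_gt0 e).
    have -> : Stot W' e = (Stot W e * K + \sum_d W d e * Q d e)%N.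
      by rewrite /Stot big_distrl -big_split /=; apply: eq_bigr => d _; rewrite -mulnDr.
    set G := (\sum_d W d e * Q d e)%N.
    have -> : (Stot W e * K + G)%:R / (K ^ t.+1)%:R =
      (Stot W e)%:R / (K ^ t)%:R * (1 + G%:R / (Stot W e)%:R / K%:R) :> R.
      rewrite expnS natrD !natrM.
      have Kt : (K ^ t)%:R != 0 :> R by rewrite pnatr_eq0 expn_eq0 negb_and -lt0n K_gt0.
      by field; rewrite Kt !lt0r_neq0.
    by rewrite ler_wpM2l ?expR_ge1Dx // divr_ge0.
  rewrite big_split /= ler_pM //.
  + by apply: prodr_ge0 => e _; rewrite divr_ge0.
  + by apply: prodr_ge0 => e _; exact: expR_ge0.
  + exact: mwu_potential hI _ hx0.
  rewrite -expR_sum ler_expR -mulr_suml ler_wpM2r ?invr_ge0 ?ler0n //.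
  exact: gain_bound.
- move=> x0 hx0 hlt d e he; rewrite /C' (mwu_zero hI hx0 hlt) // add0n.
  case hq : (Q d e) => //.
  have hd := good_demand hQ hq.
  (* A valid path of old edges costs 0, hence so does the chosen set, whereas every new edge costs
     at least 1. *)
  suff [p hp hold] : exists2 p, valid_path d p & forall e, e \in steps d.1 p -> e \in edge I.
    have := good_min hQ hd hp.
    rewrite [leqRHS]big_seq [leqRHS]big1; last by move=> e' /hold h; rewrite /wt h.
    rewrite leqn0 sum_nat_eq0 => /forallP/(_ e); rewrite hq /wt.
    by move: he; rewrite inE => /andP[/negbTE-> _]; rewrite addn1.
  (* Otherwise every valid path has a new edge, and weak duality for the indicator of new edges
     gives an objective of at least 1. *)
  apply: contrapT => hno.
  have E : LP_objective x0 = \sum_(e0 in closure_edge I) (e0 \notin edge I)%:R * x0 e0.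
    rewrite /LP_objective big_mkcond [RHS]big_mkcond; apply: eq_bigr => e' _.
    rewrite /new_edge finset.in_setD.
    by case: (e' \in edge I); case: (e' \in closure_edge I); rewrite ?mul0r ?mul1r.
  have h1 : 1 <= LP_objective x0; last by rewrite leNgt hlt in h1.
  rewrite E; apply: (weak_duality hx0 hd) => [e'|p hp]; first by rewrite ler0n.
  have [hall|] := boolP (all (mem (edge I)) (steps d.1 p)).
    by case: hno; exists p => // e' /(allP hall).
  by case/allPn=> e' he' hne; rewrite (big_rem e') //= hne lerDl sumr_ge0.
Qed.

End Step.

(** Feasibility is [mwu_cover] divided by t, since the maximum over the demands dominates each
    C(d,e). For the value, the two bounds on the potential give an objective of at most 1/K + (1 +
    1/K)^2 val(x0). *)
Lemma mwu_final t W C (eps : R) : mwu t W C -> (exists x0 : pair -> R, LP_feasible x0) ->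
  t = (K * K.+1 * (n * n * (n * n)))%N -> 4 <= eps * K%:R ->
  forall x : pair -> R, (forall e, x e = (\max_d C d e)%:R / t%:R) ->
  LP_feasible x /\ LP_objective x <= (1 + eps) * LP_value R I.
Proof.
move=> hI hfeas ht hK x hx; split.
  split; last by move=> e _; rewrite hx divr_ge0.
  move=> d hd z hz.
  have t0 : (0 : R) < t%:R.
    have n0 := pair_n_gt0 d.
    by rewrite ltr0n ht !muln_gt0 K_gt0 -muln_gt0 n0.
  rewrite -(ler_pM2r t0) mul1r; apply: le_trans (mwu_cover hI hd hz) _.
  rewrite mulr_suml; apply: ler_sum => e he; rewrite hx -mulrA divfK ?lt0r_neq0 //.
  rewrite ler_wpM2l //; first by case: hz => /(_ e he)/andP[].
  by rewrite ler_nat (@leq_bigmax _ (fun d => C d e)).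
have eps0 : 0 < eps by rewrite -(pmulr_lgt0 _ K0); apply: lt_le_trans hK; rewrite ltr0n.
suff main (x0 : pair -> R) : LP_feasible x0 -> LP_objective x <= (1 + eps) * LP_objective x0.
  have e1 : 0 < 1 + eps by lra.
  rewrite -ler_pdivrMl // /LP_value; apply: lb_le_inf.
    by case: hfeas => x0 hx0; exists (LP_objective x0), x0.
  by move=> _ [x0 hx0 <-]; rewrite ler_pdivrMl // main.
move=> hx0.
have obj0 : 0 <= LP_objective x0.
  by apply: sumr_ge0 => e; rewrite inE => /andP[_ he]; case: hx0 => _ /(_ e he).
have rhs0 : 0 <= (1 + eps) * LP_objective x0 by rewrite mulr_ge0 // addr_ge0 // ltW.
(* Below 1 no new edge was ever used, and the objective of x is 0. *)
case: (ltrP (LP_objective x0) 1) => hlt.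
  rewrite [leLHS]big1 // => e he; rewrite hx big1 ?mul0r // => d _.
  exact: mwu_zero hI _ hx0 hlt d e he.
case: (boolP [exists e : pair, true]) => [/existsP[e0 _]|/existsPn hno]; last first.
  by rewrite [leLHS]big1 // => e; case: (hno e).
have n0 := pair_n_gt0 e0.
have hpot := mwu_potential hI hx0.
have K1 : (0 : R) < K.+1%:R by rewrite ltr0n.
(* Only the demand attaining the maximum is kept in S_e; its weight is (1 + 1/K)^C K^t. *)
have hlow : \prod_(e in new_edge I) expR ((\max_d C d e)%:R / K.+1%:R) <=
    \prod_(e in new_edge I) ((Stot W e)%:R / (K ^ t)%:R) :> R.
  apply: ler_prod => e he; rewrite expR_ge0 /=.
  have [d _ ->] : exists2 d, d \in [set: pair] & \max_d C d e = C d e.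
    have := @bigop.eq_bigmax _ (fun d => C d e); case.
      by apply/card_gt0P; exists e0.
    by move=> d ->; exists d => //; rewrite inE.
  have Kt c : (0 : R) < (K ^ c)%:R by rewrite ltr0n expn_gt0 K_gt0.
  apply: (@le_trans _ _ ((W d e)%:R / (K ^ t)%:R)); last first.
    rewrite ler_wpM2r ?invr_ge0 ?ler0n // ler_nat /Stot (bigD1 d) //= leq_addr //.
  have -> : (W d e)%:R / (K ^ t)%:R = ((1 + K%:R^-1) ^+ C d e : R).
    have -> : 1 + K%:R^-1 = K.+1%:R / K%:R :> R.
      by rewrite -natr1; field; rewrite lt0r_neq0.
    rewrite expr_div_n -!natrX; apply/eqP.
    by rewrite eqr_div ?lt0r_neq0 ?Kt // -!natrM (mwu_weight hI).
  rewrite mulrC [_^-1 * _]mulrC expRM_natl lerXn2r ?nnegrE ?expR_ge0 //.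
    by rewrite addr_ge0 ?invr_ge0 // ltW.
  (* exp (1/(K+1)) <= 1 + 1/K follows by inverting exp (-1/(K+1)) >= 1 - 1/(K+1). *)
  have := expR_ge1Dx (- K.+1%:R^-1 : R).
  have -> : 1 + - K.+1%:R^-1 = (1 + K%:R^-1)^-1 :> R.
    by rewrite -natr1; field; rewrite -?natr1 ?lt0r_neq0 ?addr_gt0.
  by rewrite expRN lef_pV2 // posrE ?expR_gt0 // addr_gt0 ?invr_gt0.
move: (le_trans hlow hpot); rewrite -expR_sum ler_expR -mulr_suml.
rewrite [LP_objective x](eq_bigr (fun e => (\max_d C d e)%:R / t%:R)); last by move=> e _; rewrite hx.
rewrite -mulr_suml.
set Y := \sum_(e in new_edge I) _; set o := LP_objective x0 in hlt obj0 rhs0 *.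
set N := (n * n * (n * n))%N in ht *.
have N0 : (0 : R) < N%:R by rewrite ltr0n muln_gt0 n0.
clearbody N.
rewrite ht !natrM -natr1 => hY.
have k0 : (0 : R) < K%:R := K0; set k : R := K%:R in k0 hK hY *.
have k1 : 1 <= k by rewrite /k ler1n.
have {}hY : Y <= (k * (k + 1) * N%:R) * (k^-1 + (1 + k^-1) * (1 + k^-1) * o).
  move: hY; rewrite ler_pdivrMr ?addr_gt0 // => /le_trans; apply.
  rewrite le_eqVlt; apply/orP; left; apply/eqP; field.
  by rewrite lt0r_neq0.
have T0 : 0 < k * (k + 1) * N%:R by rewrite !mulr_gt0 ?addr_gt0.
rewrite ler_pdivrMr //; apply: le_trans hY _; rewrite [leRHS]mulrC ler_pM2l //.
have [u0 u1] : 0 < k^-1 /\ k^-1 <= 1 by rewrite invr_gt0 k0 invf_le1.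
have hu : 4 * k^-1 <= eps by rewrite ler_pdivrMr.
(* With u = 1/K <= 1 and o >= 1: u + (1 + u)^2 o <= (1 + 4 u) o <= (1 + eps) o. *)
move: (k^-1) u0 u1 hu => u u0 u1 hu.
have a1 : u * u * o <= u * o by rewrite ler_wpM2r // ler_piMr // ltW.
have a2 : 4 * u * o <= eps * o by rewrite ler_wpM2r.
have a3 : u <= u * o by rewrite ler_peMr // ltW.
lra.
Qed.

End MWU.

Local Open Scope nat_scope.

(** * Correctness of the program *)

Lemma nth_allpairs (S T U : Type) (f : S -> T -> U) x0 y0 z0 (s : seq S) (t : seq T) i j :
  i < size s -> j < size t ->
  nth z0 [seq f x y | x <- s, y <- t] (i * size t + j) = f (nth x0 s i) (nth y0 t j).
Proof.
elim: s i => [|x s IH] [|i] //= hi hj; rewrite nth_cat size_map.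
  by rewrite mul0n add0n hj (nth_map y0).
by rewrite ifF ?mulSn -?addnA ?addKn ?IH //; apply/negbTE; lia.
Qed.

(** * Row-major indices and the input encoding *)

Section Index.
Variable I : instance.
Let n := nb_vertices I.
Local Notation pair := (pair_of I).
Local Notation w := (encode I).

Definition idx (e : pair) : nat := e.1 * n + e.2.

Lemma idx_lt e : idx e < n * n.
Proof. by rewrite /idx; have := ltn_ord e.1; have := ltn_ord e.2; rewrite -/n; nia. Qed.

Lemma idx_div e : idx e %/ n = e.1.
Proof.
have n0 : 0 < n by apply: leq_ltn_trans (ltn_ord e.1).
by rewrite /idx divnMDl // divn_small ?addn0.
Qed.

Lemma idx_mod e : idx e %% n = e.2.
Proof. by rewrite /idx modnMDl modn_small. Qed.

Lemma idx_inj : injective idx.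
Proof.
move=> e e' h; rewrite [e]surjective_pairing [e']surjective_pairing.
by congr (_, _); apply: val_inj; rewrite /= -?idx_div -?idx_mod h.
Qed.

Lemma size_vertex_pairs : size (vertex_pairs I) = n * n.
Proof. by rewrite size_allpairs size_enum_ord. Qed.

Lemma nth_vertex_pairs (f : pair -> nat) e :
  nth 0 [seq f e | e <- vertex_pairs I] (idx e) = f e.
Proof.
rewrite (nth_map e) ?size_vertex_pairs ?idx_lt //; congr f.
have := @nth_allpairs _ _ _ (fun u v => (u, v)) e.1 e.2 e (enum 'I_n) (enum 'I_n) e.1 e.2.
by rewrite size_enum_ord !nth_ord_enum -surjective_pairing => ->.
Qed.

Lemma encode_edge e : nth 0 w (2 + idx e) = if e \in edge I then len e else 0.
Proof.
rewrite /encode nth_cat /= addKn nth_cat size_map size_vertex_pairs idx_lt.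
exact: (nth_vertex_pairs (fun e => if e \in edge I then len e else 0)).
Qed.

Lemma encode_demand d : nth 0 w (2 + n * n + idx d) = if d \in demand I then (Dist d).+1 else 0.
Proof.
rewrite /encode -addnA nth_cat /= addKn nth_cat size_map size_vertex_pairs.
rewrite ifF ?addKn; last by apply/negbTE; lia.
exact: (nth_vertex_pairs (fun e => if e \in demand I then (Dist e).+1 else 0)).
Qed.

Lemma size_encode : size w = 2 + 2 * (n * n).
Proof. by rewrite /encode /= size_cat !size_map size_vertex_pairs; lia. Qed.

Lemma heval_hlen s j x e : heval w s j x = idx e ->
  heval w s j (hlen x) = if e \in edge I then len e else 0.
Proof.
move=> h; rewrite /hlen /= h -encode_edge ifT //.
by have := idx_lt e; rewrite -/n; lia.
Qed.

Lemma heval_hdem s j x d : heval w s j x = idx d ->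
  heval w s j (hdem x) = if d \in demand I then (Dist d).+1 else 0.
Proof.
move=> h; rewrite /hdem /= h -encode_demand ifT //.
by have := idx_lt d; rewrite -/n; lia.
Qed.

End Index.

Lemma dist_eq (I : instance) (u v : 'I_(nb_vertices I)) k : walk_lengths u v k ->
  (forall j, walk_lengths u v j -> k <= j) -> dist u v = k.
Proof.
move=> h1 h2; rewrite /dist; case: xgetP => [j _ [j1 j2]|]; last by move=> /(_ k); case.
by apply/eqP; rewrite eqn_leq j2 // h2.
Qed.

Lemma steps_cat (T : Type) (u : T) p q : steps u (p ++ q) = steps u p ++ steps (last u p) q.
Proof. by elim: p u => //= v p IH u; rewrite -IH. Qed.

(** * Closure distances, then cheapest walks *)

Section Spec.
Variables (I : instance) (K : nat) (hq : hexp).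
Hypothesis hq_nonly : nonly hq.
Let n := nb_vertices I.
Local Notation pair := (pair_of I).
Local Notation w := (encode I).
Let Qn := (hpoly hq).[n]%R.
Hypothesis len_bound : forall e : pair, e \in edge I -> 1 <= len e <= Qn.
Let Lam := n * n * Qn + 1.

Lemma heval_hq s j : heval w s j hq = Qn.
Proof. by rewrite nonly_eval. Qed.

Lemma heval_n2 s j : heval w s j n2 = n * n. Proof. by []. Qed.

Lemma heval_hLam s j : heval w s j (hLam hq) = Lam.
Proof. by rewrite /hLam !hevalE heval_hq. Qed.

Lemma heval_ctr s j i : heval w s j (ctr i) = s i 0. Proof. by []. Qed.

Lemma heval_HN' s j : heval w s j HN = n. Proof. by []. Qed.

Lemma heval_HI1 s j : heval w s j (HI (HC 1)) = hopbound I.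
Proof. by []. Qed.

Definition encode_hevalE := (heval_hq, heval_hLam, heval_n2, heval_HI1, heval_ctr, heval_HN', hevalE).

(** The table holds [Lam] at unreachable pairs, where [dist] is 0. *)
Definition delta (e : pair) := if e \in closure_edge I then dist e.1 e.2 else Lam.

Definition elen (u : 'I_n) p := \sum_(e <- steps u p) (len e : nat).

Lemma elen_bound u p : path (@edge_rel I) u p -> elen u p <= size p * Qn.
Proof.
elim: p u => [|v p IH] u; first by rewrite /elen big_nil.
move=> /andP[uv vp]; rewrite /elen [steps _ _]/= big_cons mulSn leq_add //.
  by have /andP[] := len_bound uv.
exact: IH.
Qed.

(** After r sweeps, entries below [Lam] are lengths of walks, and no walk of at most r edges is
    shorter than its entry. The clause on edges lets a sweep append an edge through its tail. *)
Definition dist_inv (r : nat) (f : nat -> nat) : Prop :=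
  (forall e : pair, f (idx e) <= Lam /\ (f (idx e) < Lam -> walk_lengths e.1 e.2 (f (idx e)))) /\
  [/\ forall (u : 'I_n) p, path (@edge_rel I) u p -> size p <= r -> f (idx (u, last u p)) <= elen u p
    & forall e : pair, e \in edge I -> f (idx e) <= len e].

Lemma pair_gt0 (e : pair) : 0 < n.
Proof. exact: leq_ltn_trans (ltn_ord e.1). Qed.

Lemma Qn_Lam (e : pair) k : k <= n -> k * Qn < Lam.
Proof. by move=> hk; have := pair_gt0 e; rewrite /Lam addn1 ltnS leq_mul2r => h; apply/orP; right; nia. Qed.

(** Simple walks have fewer than n edges, and their length stays below [Lam]. *)
Lemma dist_inv_final r f : n <= r -> dist_inv r f -> forall e : pair, f (idx e) = delta e.
Proof.
move=> hr [h1 [h2 _]] e; rewrite /delta; have [hle hw] := h1 e.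
have simple p : path (@edge_rel I) e.1 p -> last e.1 p = e.2 ->
    f (idx e) <= elen e.1 p /\ f (idx e) < Lam.
  move=> /simple_walk[p' [k1 k2 k3 k4]] hl.
  have hs : size p' < n by have := card_uniqP k3; have := max_card (mem (e.1 :: p')); rewrite card_ord => + /= E; rewrite E.
  have := h2 e.1 p' k1; rewrite k2 hl -surjective_pairing => /(_ (leq_trans (ltnW hs) hr)) h.
  split; first by apply: leq_trans h _; exact: leq_sum_subseq.
  apply: leq_ltn_trans (leq_trans h (elen_bound k1)) _.
  by apply: (Qn_Lam e); exact: ltnW.
case: ifP => [|/negbT hc].
  rewrite finset.inE => /connectP[p hp hl].
  have [_ hlt] := simple p hp (esym hl).
  apply/esym/dist_eq; first exact: hw.
  move=> j [p' [k1 k2 ->]]; exact: (simple p' k1 k2).1.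
apply/eqP; rewrite eqn_leq hle leqNgt; apply: contra hc => /hw [p [k1 k2 _]].
by rewrite finset.inE; apply/connectP; exists p.
Qed.

Lemma p_dist_spec s : forall e : pair, run w (p_dist hq) s aDL (idx e) = delta e.
Proof.
suff h : dist_inv n (run w (p_dist hq) s aDL) by exact: (dist_inv_final (leqnn n) h).
rewrite /p_dist run_seq.
set s0 := run _ _ s.
have i0 : dist_inv 0 (s0 aDL).
  have E e : s0 aDL (idx e) = if e.1 == e.2 then 0 else if e \in edge I then len e else Lam.
    rewrite /s0 run_tabE ?heval_n2 ?idx_lt // !encode_hevalE (@heval_hlen _ _ _ _ e) //.
    rewrite idx_div idx_mod -val_eqE.
    case: ifP => // _; case he: (e \in edge I) => //.
    by have := len_bound he; case: (len e).
  split.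
    move=> e; rewrite E; case: ifP => [/eqP h|_].
      split=> // _; exists [::]; split=> //.
      by rewrite big_nil.
    case: ifP => he; last by rewrite leqnn ltnn.
    have /andP[_ hl] := len_bound he; split.
      by apply: leq_trans hl _; rewrite -[leqLHS]mul1n ltnW // (Qn_Lam e) //; exact: pair_gt0 e.
    move=> _; exists [:: e.2]; rewrite /= /edge_rel -surjective_pairing he; split=> //.
    by rewrite big_cons big_nil addn0 -surjective_pairing.
  split; last by move=> e he; rewrite E he; case: ifP.
  by move=> u [|//] _ _; rewrite E eqxx.
rewrite -{1}(subn0 n); apply: (iter_ind (Inv := fun k s' => dist_inv (n - k) (s' aDL))) => //; first by rewrite subnn.
move=> k s1 hk _ _ i1.
(* Entries are compared with those at the start of the sweep; an edge (y, v) can be appended once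
   the sweep has passed y, and y runs downwards. *)
pose Inv m (s2 : store) := [/\
  forall e : pair, s2 aDL (idx e) <= s1 aDL (idx e),
  forall e : pair, s2 aDL (idx e) < Lam -> walk_lengths e.1 e.2 (s2 aDL (idx e)) &
  forall (u y v : 'I_n), m <= y -> (y, v) \in edge I ->
    s2 aDL (idx (u, v)) <= s1 aDL (idx (u, y)) + len (y, v)].
have : Inv 0 (run w (PIter iY HN p_dstep) s1).
  apply: iter_ind => //.
    split=> //; first by move=> e; exact: (i1.1 e).2.
    by move=> u y v; have := ltn_ord y; rewrite [heval _ _ _ _]/= -/n; lia.
  move=> m s2 hm hc _ [j1 j2 j3].
  pose y := Ordinal (hm : m < n).
  have E e : run w p_dstep s2 aDL (idx e) =
      minn (s2 aDL (idx e)) (s2 aDL (idx (e.1, y)) + s2 aDL (idx (y, e.2))).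
    rewrite /p_dstep run_tabE ?heval_n2 ?idx_lt // !encode_hevalE hc idx_div idx_mod.
    by [].
  split.
  - by move=> e; rewrite E; apply: leq_trans (geq_minl _ _) _.
  - move=> e; rewrite E; case: (leqP (s2 aDL (idx e)) _) => [_|_ hlt]; first exact: j2.
    have [p1 [a1 a2 a3]] : walk_lengths e.1 y (s2 aDL (idx (e.1, y))) by apply: (j2 (e.1, y)); lia.
    have [p2 [b1 b2 b3]] : walk_lengths y e.2 (s2 aDL (idx (y, e.2))) by apply: (j2 (y, e.2)); lia.
    exists (p1 ++ p2); split; first by rewrite cat_path a1 a2.
      by rewrite last_cat a2.
    by rewrite steps_cat big_cat /= a2 -a3 -b3.
  - move=> u y' v; rewrite leq_eqVlt => /orP[/eqP hy|hy] he; rewrite E; last first.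
      by apply: leq_trans (geq_minl _ _) _; exact: j3.
    have -> : y' = y by exact: val_inj.
    apply: leq_trans (geq_minr _ _) _; apply: leq_add; first exact: j1.
    apply: leq_trans (j1 _) _; case: i1 => _ [_ h]; apply: h.
    by rewrite (_ : y = y') //; exact: val_inj.
set s3 := run _ _ _ => -[j1 j2 j3].
case: i1 => i1 [i2 i3]; split.
  by move=> e; split; [apply: leq_trans (j1 e) _; case: (i1 e) | exact: j2].
split; last by move=> e he; apply: leq_trans (j1 e) _; exact: i3.
move=> u p; case/lastP: p => [|p v] hp hs.
  by apply: leq_trans (j1 _) _; exact: (i2 u [::]).
move: hp hs; rewrite rcons_path last_rcons size_rcons => /andP[hp hv] hs.
apply: leq_trans (j3 u (last u p) v (leq0n _) hv) _.
rewrite /elen -cats1 steps_cat big_cat /= big_cons big_nil addn0 leq_add2r.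
by apply: i2 => //; lia.
Qed.

(** * Dynamic programming over demands, budgets and vertices *)

Definition state_index (d : pair) (L : nat) (v : 'I_n) : nat := (idx d * Lam + L) * n + v.
Definition pair_index (j : nat) (e : pair) : nat := j * (n * n) + idx e.
Let ND := n * n * Lam * n.

Lemma state_index_lt d L v : L < Lam -> state_index d L v < ND.
Proof.
move=> hL; rewrite /state_index /ND; apply: (@leq_trans ((idx d * Lam + L).+1 * n)).
  by rewrite mulSn addnC ltn_add2r.
rewrite leq_mul2r; apply/orP; right.
apply: (@leq_trans ((idx d).+1 * Lam)); first by rewrite mulSn [Lam + _]addnC ltn_add2l.
by rewrite leq_mul2r idx_lt orbT.
Qed.

Lemma state_index_v d L v : state_index d L v %% n = v.
Proof. by rewrite /state_index modnMDl modn_small. Qed.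

Lemma state_index_n d L v : state_index d L v %/ n = idx d * Lam + L.
Proof. by rewrite /state_index divnMDl ?divn_small ?addn0 // (pair_gt0 d). Qed.

Lemma state_index_L d L v : L < Lam -> state_index d L v %/ n %% Lam = L.
Proof. by move=> hL; rewrite state_index_n modnMDl modn_small. Qed.

Lemma state_index_d d L v : L < Lam -> state_index d L v %/ n %/ Lam = idx d.
Proof. by move=> hL; rewrite state_index_n divnMDl ?divn_small ?addn0 // /Lam addn1. Qed.

Lemma pair_index_lt j e N : j < N -> pair_index j e < N * (n * n).
Proof.
move=> hj; apply: (@leq_trans (j.+1 * (n * n))); last by rewrite leq_mul2r hj orbT.
by rewrite /pair_index mulSn [n * n + _]addnC ltn_add2l idx_lt.
Qed.

Lemma pair_index_div j e : pair_index j e %/ (n * n) = j.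
Proof.
have h := idx_lt e.
by rewrite /pair_index divnMDl ?divn_small ?addn0 //; apply: leq_ltn_trans h.
Qed.

Lemma pair_index_mod j e : pair_index j e %% (n * n) = idx e.
Proof. by rewrite /pair_index modnMDl modn_small // idx_lt. Qed.

Lemma heval_nD s j : heval w s j (nD hq) = ND.
Proof. by rewrite /nD /ND !encode_hevalE. Qed.

Lemma heval_nQ s j : heval w s j (nQ hq) = ND * (n * n).
Proof. by rewrite /nQ heval_HMul heval_nD. Qed.

Section Relax.
Variables (s : store) (u : 'I_n).
Hypotheses (hu : s iU 0 = u) (hdl : forall e, s aDL (idx e) = delta e).

Definition candn d L v := s aD0 (state_index d (L - delta (u, v)) u) + s aT (pair_index (idx d) (u, v)).
Definition condn d L v :=
  [&& s iH 0 < hopbound I, delta (u, v) <= L & candn d L v < s aD1 (state_index d L v)].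

Section Eval.
Variables (j : nat) (x : hexp) (d : pair) (L : nat) (v : 'I_n).
Hypotheses (hx : heval w s j x = state_index d L v) (hL : L < Lam).

Lemma heval_jUV : heval w s j (jUV x) = idx (u, v).
Proof. by rewrite /jUV /jv heval_HAdd heval_HMul heval_hmod !encode_hevalE hx hu state_index_v. Qed.

Lemma heval_jd : heval w s j (jd hq x) = idx d.
Proof. by rewrite /jd 2!heval_HDiv heval_hLam hx state_index_d. Qed.

Lemma heval_jL : heval w s j (jL hq x) = L.
Proof. by rewrite /jL heval_hmod heval_HDiv heval_hLam hx state_index_L. Qed.

Lemma heval_src : heval w s j (src hq x) = state_index d (L - delta (u, v)) u.
Proof.
rewrite /src /hstate heval_HAdd heval_HMul heval_HAdd heval_HMul heval_hLam heval_jd.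
by rewrite heval_HSub heval_jL heval_HG heval_jUV hdl heval_ctr hu.
Qed.

Lemma heval_cand : heval w s j (cand hq x) = candn d L v.
Proof.
rewrite /cand heval_HAdd !heval_HG heval_src heval_HAdd heval_HMul heval_n2.
by rewrite heval_jUV heval_jd.
Qed.

Lemma heval_cond : (heval w s j (cond hq x) != 0) = condn d L v.
Proof.
rewrite /cond /condn !heval_hand !heval_hlt heval_hle !eqb0 !negbK heval_cand.
by rewrite !heval_HG heval_jUV heval_jL hx hdl heval_HI1 -andbA.
Qed.
End Eval.

Lemma relax_Q d L v e : L < Lam ->
  run w (p_relax hq) s aQ1 (pair_index (state_index d L v) e) =
  if condn d L v then (if e == (u, v) then 1 else s aQ0 (pair_index (state_index d (L - delta (u, v)) u) e))
  else s aQ1 (pair_index (state_index d L v) e).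
Proof.
move=> hL; rewrite /p_relax run_seq frame //.
rewrite run_tabE ?heval_nQ; last by apply: pair_index_lt; exact: state_index_lt.
have hx : heval w s (pair_index (state_index d L v) e) (HDiv HJ n2) = state_index d L v.
  by rewrite heval_HDiv heval_HJ heval_n2 pair_index_div.
rewrite heval_hite (heval_cond hx hL); case: ifP => // _.
rewrite heval_hite heval_heq (heval_jUV hx) heval_hmod heval_HJ heval_n2 pair_index_mod.
rewrite (inj_eq (@idx_inj I)) eqb0 negbK; case: ifP => // _.
by rewrite heval_HG heval_HAdd heval_HMul (heval_src hx hL) heval_n2 heval_hmod heval_HJ heval_n2 pair_index_mod.
Qed.
End Relax.

(** The table of edge sets has already been rewritten here, but neither test nor candidate reads
    [aQ1]. *)
Lemma relax_D (s : store) (u : 'I_n) d L v : s iU 0 = u -> (forall e, s aDL (idx e) = delta e) -> L < Lam ->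
  run w (p_relax hq) s aD1 (state_index d L v) =
  if condn s u d L v then candn s u d L v else s aD1 (state_index d L v).
Proof.
move=> hu hdl hL; rewrite /p_relax run_seq.
rewrite run_tabE ?heval_nD; last exact: state_index_lt.
set s1 := run _ _ _.
have hx : heval w s1 (state_index d L v) HJ = state_index d L v by [].
by rewrite heval_hite (@heval_cond s1 u hu hdl _ _ _ _ _ hx hL) (@heval_cand s1 u hu hdl _ _ _ _ _ hx hL).
Qed.

Section DP.
Variable T : pair -> pair -> nat.
Let INF := n * (K * (n * n) + 1) + 1.

Definition reach (d : pair) L (v : 'I_n) h p :=
  [/\ path (@closure_rel I) d.1 p, last d.1 p = v, size p <= h
    & \sum_(e <- steps d.1 p) dist e.1 e.2 <= L].

Definition walk_cost d p := \sum_(e <- steps d.1 p) T d e.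

Definition dp_complete h (D : nat -> nat) := forall d L v, L < Lam ->
  forall p, reach d L v h p -> D (state_index d L v) <= walk_cost d p.

(** An inequality for the cost of the edge set, since a walk may repeat a step that the set counts
    once. *)
Definition dp_sound h (D Q : nat -> nat) := forall d L v, L < Lam ->
  D (state_index d L v) <= INF /\
  (D (state_index d L v) < INF ->
     (exists2 p, reach d L v h p & forall e, e \in steps d.1 p -> Q (pair_index (state_index d L v) e) != 0) /\
     \sum_(e | Q (pair_index (state_index d L v) e) != 0) T d e <= D (state_index d L v)).

Definition dp_store (s : store) :=
  (forall e, s aDL (idx e) = delta e) /\ (forall d e, s aT (pair_index (idx d) e) = T d e).

Lemma reach_mono d L v h p L' h' : L <= L' -> h <= h' -> reach d L v h p -> reach d L' v h' p.
Proof. by move=> hL hh [? ? h1 h2]; split=> //; [exact: leq_trans hh | exact: leq_trans hL]. Qed.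

(** Budgets are below [Lam], so they rule out pairs outside the closure. *)
Lemma delta_lt e : delta e < Lam -> e \in closure_edge I /\ delta e = dist e.1 e.2.
Proof. by rewrite /delta; case: ifP => //; rewrite ltnn. Qed.

Lemma reach_rcons d L (u v : 'I_n) h p : L < Lam -> delta (u, v) <= L ->
  reach d (L - delta (u, v)) u h p -> reach d L v h.+1 (rcons p v).
Proof.
move=> hL hd [h1 h2 h3 h4]; have [hc he] := delta_lt (leq_ltn_trans hd hL).
split; first by rewrite rcons_path h1 h2.
- by rewrite last_rcons.
- by rewrite size_rcons.
rewrite -cats1 steps_cat big_cat /= big_cons big_nil addn0 h2.
by move: h4; rewrite he /= in hd *; rewrite leq_subRL // addnC.
Qed.

(** [b] tells whether the hop is within the hopbound; the sources u >= m have been treated. *)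
Definition relax_inv (s : store) h (b : bool) m (s' : store) := [/\
  dp_store s',
  forall d L v, L < Lam -> s' aD1 (state_index d L v) <= s aD0 (state_index d L v),
  b -> forall d L (u v : 'I_n), L < Lam -> m <= u -> delta (u, v) <= L ->
     s' aD1 (state_index d L v) <= s aD0 (state_index d (L - delta (u, v)) u) + T d (u, v) &
  dp_sound (h + b) (s' aD1) (s' aQ1)].

Lemma relax_step s h b m s' : dp_sound h (s aD0) (s aQ0) ->
  (forall l, s' aD0 l = s aD0 l) -> (forall l, s' aQ0 l = s aQ0 l) ->
  b = (s' iH 0 < hopbound I) -> m < n -> s' iU 0 = m ->
  relax_inv s h b m.+1 s' -> relax_inv s h b m (run w (p_relax hq) s').
Proof.
move=> hs hD hQ hb hm hu [[i1 i2] i3 i4 i5].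
pose u := Ordinal (hm : m < n).
have huE : s' iU 0 = u by [].
have ED d L v hL := @relax_D s' u d L v huE i1 hL.
have EQ d L v e hL := @relax_Q s' u huE i1 d L v e hL.
have candE d L v : candn s' u d L v = s aD0 (state_index d (L - delta (u, v)) u) + T d (u, v).
  by rewrite /candn hD i2.
have decr d L v : L < Lam -> run w (p_relax hq) s' aD1 (state_index d L v) <= s' aD1 (state_index d L v).
  by move=> hL; rewrite ED //; case: ifP => // /and3P[_ _ /ltnW].
split.
- split=> [e|d e]; first by rewrite frame //; exact: i1.
  by rewrite frame //; exact: i2.
- by move=> d L v hL; apply: leq_trans (decr _ _ _ hL) _; exact: i3.
- move=> b1 d L u' v hL; rewrite leq_eqVlt => /orP[/eqP hmu|hmu] hdl; last first.
    by apply: leq_trans (decr _ _ _ hL) _; exact: i4.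
  have -> : u' = u by apply: val_inj.
  have hdl' : delta (u, v) <= L by rewrite (_ : u = u') //; apply: val_inj.
  rewrite ED // /condn -hb b1 hdl' /= candE.
  by case: ltnP.
move=> d L v hL; rewrite ED //.
have hQE e : run w (p_relax hq) s' aQ1 (pair_index (state_index d L v) e) = _ := EQ d L v e hL.
case: ifP hQE => hc hQE; last first.
  have [j1 j2] := i5 d L v hL; split=> // /j2[[p k1 k2] k3]; split.
    by exists p => // e he; rewrite hQE k2.
  by under eq_bigl do rewrite hQE.
case/and3P: hc; rewrite -hb candE => b1 hdl hlt.
move: (run w (p_relax hq) s' aQ1) hQE => f hQE.
have [j1 _] := i5 d L v hL.
split; first by apply: ltnW; exact: leq_trans hlt j1.
move=> _; have hL' : L - delta (u, v) < Lam by apply: leq_ltn_trans (leq_subr _ _) hL.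
(* The candidate beats an entry of at most [INF], so the predecessor state is below [INF] and
   carries a walk. *)
have [_ /(_ _)[|[p k1 k2] k3]] := hs d (L - delta (u, v)) u hL'.
  by apply: leq_trans j1; apply: leq_ltn_trans hlt; exact: leq_addr.
split.
  exists (rcons p v).
    by rewrite b1 addn1; exact: (reach_rcons hL hdl k1).
  move=> e; rewrite -cats1 steps_cat mem_cat hQE; case: (k1) => _ -> _ _.
  case: (altP (e =P (u, v))) => // ne; rewrite hQ => /orP[/k2//|].
  by rewrite /steps /= inE (negbTE ne).
(* Adding (u, v) to the set costs at most [T d (u, v)], and nothing if it is already there. *)
apply: (@leq_trans (\sum_(e | s aQ0 (pair_index (state_index d (L - delta (u, v)) u) e) != 0) T d e + T d (u, v))).
  rewrite (bigD1 (u, v)) /=; last by rewrite hQE eqxx.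
  rewrite addnC leq_add2r big_mkcond [leqRHS]big_mkcond leq_sum // => e _.
  by rewrite hQE; case: (altP (e =P (u, v))); rewrite ?andbF ?andbT // hQ.
by rewrite leq_add2r.
Qed.

Lemma hop_step s h k : dp_store s -> dp_complete h (s aD0) -> dp_sound h (s aD0) (s aQ0) ->
  s iH 0 = k -> let s' := run w (p_hop hq) s in let h' := h + (k < hopbound I) in
  [/\ dp_store s', dp_complete h' (s' aD0) & dp_sound h' (s' aD0) (s' aQ0)].
Proof.
move=> hst hc hs hk s' h'.
set b := k < hopbound I in h' *.
pose s1 := run w (PTab aQ1 (nQ hq) (HG aQ0 HJ)) (run w (PTab aD1 (nD hq) (HG aD0 HJ)) s).
pose s2 := run w (PIter iU HN (p_relax hq)) s1.
have [[q1 q2] q3 q4 q5] : relax_inv s h b 0 s2.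
  apply: iter_ind => //.
    have e1 d L v : L < Lam -> s1 aD1 (state_index d L v) = s aD0 (state_index d L v).
      by move=> hL; rewrite /s1 frame // run_tabE ?heval_nD // state_index_lt.
    have e2 d L v e : L < Lam -> s1 aQ1 (pair_index (state_index d L v) e) = s aQ0 (pair_index (state_index d L v) e).
      by move=> hL; rewrite /s1 run_tabE ?heval_nQ ?pair_index_lt ?state_index_lt.
    split.
    - by split=> [e|d e]; rewrite /s1 !frame //; [exact: hst.1 | exact: hst.2].
    - by move=> d L v hL; rewrite e1.
    - by move=> _ d L u v _; have := ltn_ord u; rewrite heval_HN' -/n; lia.
    move=> d L v hL; have [j1 j2] := hs d L v hL; rewrite e1 //; split=> // /j2[[p k1 k2] k3].
    split; last by under eq_bigl do rewrite e2 //.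
    exists p; last by move=> e he; rewrite e2 // k2.
    by apply: reach_mono k1 => //; exact: leq_addr.
  move=> m s3 hm hu hfr; apply: relax_step => //.
  - by move=> l; rewrite hfr // /s1 !frame.
  - by move=> l; rewrite hfr // /s1 !frame.
  by rewrite hfr // /s1 !frame // hk.
have -> : s' = run w (PTab aQ0 (nQ hq) (HG aQ1 HJ)) (run w (PTab aD0 (nD hq) (HG aD1 HJ)) s2) by [].
set s4 := run _ _ _.
have e1 d L v : L < Lam -> s4 aD0 (state_index d L v) = s2 aD1 (state_index d L v).
  by move=> hL; rewrite /s4 frame // run_tabE ?heval_nD // state_index_lt.
have e2 d L v e : L < Lam -> s4 aQ0 (pair_index (state_index d L v) e) = s2 aQ1 (pair_index (state_index d L v) e).
  by move=> hL; rewrite /s4 run_tabE ?heval_nQ ?pair_index_lt ?state_index_lt.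
split.
- by split=> [e|d e]; rewrite /s4 !frame //.
- move=> d L v hL p; rewrite e1 //.
  (* Walks of at most h steps are covered by the last hop; a longer one has h + 1 steps and is split
     before its last step. *)
  move=> [k1 k2 k3 k4]; case: (leqP (size p) h) => hp.
    by apply: leq_trans (q3 _ _ _ hL) _; apply: hc.
  have b1 : b by move: k3 hp; rewrite /h'; case: (b) => //; lia.
  case/lastP: p k1 k2 k3 k4 hp => [//|p x]; rewrite rcons_path last_rcons size_rcons.
  move=> /andP[k1 kx] <- {v}; rewrite /h' b1 addn1 ltnS => k3 k4 _.
  move: k4; rewrite /walk_cost -cats1 steps_cat !big_cat /= !big_cons !big_nil !addn0 => k4.
  have hde : delta (last d.1 p, x) = dist (last d.1 p) x by rewrite /delta ifT.
  have hle : delta (last d.1 p, x) <= L by rewrite hde; apply: leq_trans k4; exact: leq_addl.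
  apply: leq_trans (q4 b1 d L (last d.1 p) x hL (leq0n _) hle) _.
  rewrite leq_add2r; apply: hc; first by apply: leq_ltn_trans hL; exact: leq_subr.
  by rewrite hde in hle *; split=> //; rewrite leq_subRL // addnC.
move=> d L v hL; have [j1 j2] := q5 d L v hL; rewrite e1 //; split=> // /j2[[p k1 k2] k3].
split; last by under eq_bigl do rewrite e2 //.
by exists p => // e he; rewrite e2 // k2.
Qed.

Lemma p_dp_spec s : dp_store s -> let s' := run w (p_dp K hq) s in let h := minn n (hopbound I) in
  dp_complete h (s' aD0) /\ dp_sound h (s' aD0) (s' aQ0).
Proof.
move=> hst s' h.
pose s1 := run w (PTab aQ0 (nQ hq) (HC 0)) (run w
  (PTab aD0 (nD hq) (hite (heq (jv HJ) (HDiv (jd hq HJ) HN)) (HC 0) (hinf K))) s).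
have e1 d L v : L < Lam -> s1 aD0 (state_index d L v) = if d.1 == v then 0 else INF.
  move=> hL; rewrite /s1 frame // run_tabE ?heval_nD ?state_index_lt //.
  rewrite heval_hite heval_heq eqb0 negbK.
  have hx : heval w s (state_index d L v) HJ = state_index d L v by [].
  rewrite heval_HDiv (heval_jd hx hL) /jv heval_hmod heval_HJ heval_HN' state_index_v idx_div.
  by rewrite -val_eqE eq_sym /hinf !encode_hevalE /INF.
have e2 d L v e : L < Lam -> s1 aQ0 (pair_index (state_index d L v) e) = 0.
  by move=> hL; rewrite /s1 run_tabE ?heval_nQ ?pair_index_lt ?state_index_lt.
(* The counters n-1, ..., k are done, and min (n, hopbound) - k of them lie below the hopbound. *)
pose Inv k (s2 : store) := let h' := minn n (hopbound I) - k in
  [/\ dp_store s2, dp_complete h' (s2 aD0) & dp_sound h' (s2 aD0) (s2 aQ0)].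
have : Inv 0 s'.
  apply: (@iter_ind _ Inv iH HN (p_hop hq) s1) => //.
    rewrite /Inv heval_HN' (_ : _ - n = 0); last by rewrite -/n; lia.
    split.
    - by split=> [e|d e]; rewrite /s1 !frame //; [exact: hst.1 | exact: hst.2].
    - move=> d L v hL p [_ h2 h3 _]; rewrite e1 //.
      by move: h2 h3; case: p => [|x p]; rewrite ?leqn0 //= => -> _; rewrite eqxx.
    move=> d L v hL; rewrite e1 //; case: eqP => hv; last by rewrite leqnn ltnn.
    split=> // _; split; last by rewrite big1 // => e; rewrite e2.
    by exists [::] => //; split=> //; rewrite big_nil.
  move=> k s2 hk hc hfr [i1 i2 i3].
  have := hop_step i1 i2 i3 hc.
  have -> : minn n (hopbound I) - k.+1 + (k < hopbound I) = minn n (hopbound I) - k; last by [].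
  move: hk; rewrite heval_HN' -/n; case: (ltnP k (hopbound I)) => /=; lia.
by rewrite /Inv subn0 => -[].
Qed.

End DP.

End Spec.

(** A walk of length k makes the set nonempty, so a least length exists and the default of [xget] is
    not taken. *)
Lemma dist_le (I : instance) (u v : 'I_(nb_vertices I)) k : walk_lengths u v k -> dist u v <= k.
Proof.
move=> hk.
have hex : exists k, `[< walk_lengths u v k >] by exists k; exact/asboolP.
have [m /asboolP hm hmin] := ex_minnP hex.
have hmin' j : walk_lengths u v j -> m <= j by move=> hj; apply: hmin; exact/asboolP.
by rewrite (dist_eq hm hmin') hmin'.
Qed.

Lemma perm_idx (I : instance) :
  perm_eq [seq idx e | e <- enum {: pair_of I}] (iota 0 (nb_vertices I * nb_vertices I)).
Proof.
set s := map _ _; set t := iota _ _.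
have us : uniq s by rewrite map_inj_uniq ?enum_uniq //; exact: idx_inj.
have st : {subset s <= t} by move=> _ /mapP[e _ ->]; rewrite mem_iota add0n idx_lt.
apply: uniq_perm => //; first exact: iota_uniq.
have hsz : size t <= size s by rewrite size_iota size_map -cardE card_prod card_ord.
by have [_ h] := uniq_min_size us st hsz.
Qed.

Lemma big_idx (I : instance) (R : Type) (x0 : R) (op : Monoid.com_law x0) (F : nat -> R) :
  \big[op/x0]_(0 <= i < nb_vertices I * nb_vertices I) F i = \big[op/x0]_(e : pair_of I) F (idx e).
Proof. by rewrite /index_iota subn0 -(perm_big _ (perm_idx I)) big_map enumT. Qed.

(** * Each round of the program is a step of multiplicative weights *)

Section Rounds.
Variables (I : instance) (K : nat) (hq : hexp).
Hypothesis K_gt0 : 0 < K.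
Hypothesis hq_nonly : nonly hq.
Let n := nb_vertices I.
Local Notation pair := (pair_of I).
Local Notation w := (encode I).
Let Qn := (hpoly hq).[n]%R.
Hypothesis len_bound : forall e : pair, e \in edge I -> 1 <= len e <= Qn.
Let Lam := n * n * Qn + 1.
Local Notation table s a := (fun d e : pair => s a (pair_index (idx d) e)).
Local Notation delta := (delta hq).
Local Notation state_index := (state_index hq).


Lemma heval_n4 s j : heval w s j n4 = n * n * (n * n). Proof. by []. Qed.

Lemma idx2_lt (d e : pair) : pair_index (idx d) e < n * n * (n * n).
Proof. by apply: pair_index_lt; exact: idx_lt. Qed.

Section FoldDemands.
Variables (op : Monoid.com_law 0) (a b : nat) (hop : hexp -> hexp -> hexp).
Hypothesis opE : forall s j x y, heval w s j (hop x y) = op (heval w s j x) (heval w s j y).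
Hypotheses (ab : b != a) (ai : a != iD) (bi : b != iD).

(** Stated for any commutative monoid law, to serve both the sums S_e and the final maxima. *)
Lemma fold_demands_spec s (e : pair) : (forall k, k < n * n -> s a k = 0) ->
  run w (PIter iD n2 (PTab a n2 (hop (HG a HJ) (HG b (HAdd (HMul (ctr iD) n2) HJ))))) s a (idx e)
  = \big[op/0]_(d : pair) s b (pair_index (idx d) e).
Proof.
move=> h0.
pose Inv k (s' : store) := (forall l, s' b l = s b l) /\
  s' a (idx e) = \big[op/0]_(k <= i < n * n) s b (i * (n * n) + idx e).
rewrite -(big_idx I op (fun i => s b (i * (n * n) + idx e))).
suff [] : Inv 0 (run w (PIter iD n2 (PTab a n2 (hop (HG a HJ) (HG b (HAdd (HMul (ctr iD) n2) HJ))))) s) by [].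
apply: iter_ind.
- by rewrite /= mem_seq1 eq_sym.
- by split=> //; rewrite heval_n2 big_geq // h0 // idx_lt.
- move=> k x s' [h1 h2]; split=> [l|]; first by rewrite /set_counter (negbTE bi) /= h1.
  by rewrite /set_counter (negbTE ai) /= h2.
move=> k s' hk hc _ [h1 h2]; split=> [l|]; first by rewrite frame ?h1 //= mem_seq1.
rewrite run_tabE ?heval_n2 ?idx_lt // opE !heval_HG heval_HAdd heval_HMul heval_n2 heval_ctr hc.
by rewrite h1 h2 [RHS]big_ltn // Monoid.mulmC.
Qed.
End FoldDemands.

Lemma p_weights_spec (s : store) : let s' := run w (p_weights K) s in
  (forall a, a \notin [:: aS; iD; aT] -> forall l, s' a l = s a l) /\
  (forall d e : pair, s' aT (pair_index (idx d) e) = wt K (table s aW) d e).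
Proof.
move=> s'; split=> [a ha l|d e].
  rewrite /s' frame //; apply: contra ha; rewrite /= !inE.
  by case: (a == 4); case: (a == 12); case: (a == 3).
rewrite /s' /p_weights run_seq; set s1 := run w _ s; rewrite run_seq; set s2 := run w _ s1.
have hS : s2 aS (idx e) = Stot (table s aW) e.
  rewrite /s2 (@fold_demands_spec addn aS aW HAdd) //.
  by move=> k hk; rewrite /s1 run_tabE.
rewrite run_tabE ?heval_n4 ?idx2_lt // heval_hite.
have hm j : heval w s2 (pair_index j e) (hmod HJ n2) = idx e.
  by rewrite heval_hmod heval_n2 heval_HJ pair_index_mod.
rewrite (@heval_hlen _ _ _ _ e) // /wt.
have -> : ((if e \in edge I then len e else 0) != 0) = (e \in edge I).
  by case: ifP => // he; have := len_bound he; case: (len e).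
case: ifP => // _.
rewrite heval_HAdd heval_HDiv heval_HMul !heval_HG hm hS.
rewrite /hM heval_HMul heval_n2 heval_HJ !heval_HC; congr (_ * _ %/ _ + 1).
by rewrite /s2 frame // /s1 frame.
Qed.

(** The distance bound clipped to the largest budget in the table. *)
Definition Lbound (d : pair) := minn (Dist d) (n * n * Qn).

Definition chosen (Q : nat -> nat) (d e : pair) : bool :=
  (d \in demand I) && (Q (pair_index (state_index d (Lbound d) d.2) e) != 0).

Lemma p_update_spec s : let s' := run w (p_update K hq) s in
  (forall a, a \notin [:: aDQ; aW; aC] -> forall l, s' a l = s a l) /\
  (forall d e : pair, s' aW (pair_index (idx d) e) = table s aW d e * (K + chosen (s aQ0) d e) /\
               s' aC (pair_index (idx d) e) = table s aC d e + chosen (s aQ0) d e).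
Proof.
move=> s'; split=> [a ha l|d e].
  exact: frame.
rewrite /s' /p_update run_seq; set s1 := run w _ s; rewrite run_seq; set s2 := run w _ s1.
have hQ : s1 aDQ (pair_index (idx d) e) = chosen (s aQ0) d e.
  rewrite /s1 run_tabE ?heval_n4 ?idx2_lt // heval_hand.
  have hd s0 : heval w s0 (pair_index (idx d) e) (HDiv HJ n2) = idx d.
    by rewrite heval_HDiv heval_n2 heval_HJ pair_index_div.
  rewrite (@heval_hdem _ _ _ _ d) // /chosen; case: (boolP (d \in demand I)) => // hdem.
  rewrite heval_HG heval_HAdd heval_HMul heval_hmod heval_HJ heval_n2 pair_index_mod.
  rewrite /hstate heval_HAdd heval_HMul heval_HAdd heval_HMul heval_hmod hd heval_hLam //.
  rewrite heval_hmin heval_HSub (@heval_hdem _ _ _ _ d) // hdem heval_HC subn1 /=.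
  by rewrite -/n heval_hq // idx_mod.
split.
  rewrite frame // /s2 run_tabE ?heval_n4 ?idx2_lt //.
  rewrite heval_HMul heval_HAdd heval_hsg !heval_HG heval_HC heval_HJ hQ eqb0 negbK.
  by rewrite /s1 frame.
rewrite run_tabE ?heval_n4 ?idx2_lt // heval_HAdd heval_hsg !heval_HG heval_HJ.
have -> : s2 aDQ (pair_index (idx d) e) = chosen (s aQ0) d e by rewrite -hQ /s2 frame.
by rewrite eqb0 negbK /s2 frame // /s1 frame.
Qed.

Lemma dist_closure_le e : e \in closure_edge I -> dist e.1 e.2 <= n * Qn.
Proof.
rewrite finset.inE => /connectP[p hp hl]; have [p' [k1 k2 k3 _]] := simple_walk hp.
have hs : size p' <= n.
  have := card_uniqP k3; have := max_card (mem (e.1 :: p')).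
  by rewrite card_ord => + /= E; rewrite E => /ltnW.
apply: (@leq_trans (elen e.1 p')).
  by apply: dist_le; exists p'; rewrite k2.
by apply: leq_trans (elen_bound len_bound k1) _; rewrite leq_mul2r hs orbT.
Qed.

(** A simple path has at most n steps, each of length at most [n * Qn], so clipping budget and
    hopbound excludes no valid path. *)
Lemma valid_path_reach d p : valid_path d p -> reach d (Lbound d) d.2 (minn n (hopbound I)) p.
Proof.
move=> [h1 h2 h3 h4 h5].
have hs : size p <= n.
  have := card_uniqP h3; have := max_card (mem (d.1 :: p)).
  by rewrite card_ord => + /= E; rewrite E => /ltnW.
split=> //; first by rewrite leq_min hs.
rewrite leq_min h5 /=.
apply: (@leq_trans (size p * (n * Qn))); last by rewrite -mulnA leq_mul2r hs orbT.
rewrite -(size_steps d.1 p) -sum1_size big_distrl /= big_seq [leqRHS]big_seq.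
by apply: leq_sum => e he; rewrite mul1n; apply: dist_closure_le; exact: step_closure he.
Qed.

Lemma wt_bound W (d e : pair) : wt K W d e <= K * (n * n) + 1.
Proof.
rewrite /wt; case: ifP => // _; rewrite leq_add2r.
have hW : W d e <= Stot W e by rewrite /Stot (bigD1 d) //= leq_addr.
case: (posnP (Stot W e)) => [->|S0]; first by rewrite divn0.
by rewrite -(leq_pmul2r S0); apply: leq_trans (leq_divM _ _) _; rewrite leq_mul2l hW orbT.
Qed.

(** A valid path has at most n steps of cost at most K n^2 + 1, which keeps the entry of its demand
    finite; soundness then yields the walk, and completeness its minimality. *)
Lemma dp_good W D Q : (forall d, d \in demand I -> exists p, valid_path d p) ->
  dp_complete hq (wt K W) (minn n (hopbound I)) D ->
  dp_sound K hq (wt K W) (minn n (hopbound I)) D Q -> good K W (chosen Q).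
Proof.
move=> hex hc hs.
have hL d : Lbound d < n * n * Qn + 1 by rewrite addn1 ltnS geq_minr.
have hcost d p : valid_path d p -> D (state_index d (Lbound d) d.2) <= walk_cost (wt K W) d p.
  by move=> hp; apply: hc (hL d) _ _; exact: valid_path_reach.
have hfin d : d \in demand I -> D (state_index d (Lbound d) d.2) < n * (K * (n * n) + 1) + 1.
  move=> /hex[p hp]; rewrite addn1 ltnS; apply: leq_trans (hcost d p hp) _.
  have [_ _ hsz _] := valid_path_reach hp.
  apply: (@leq_trans (size p * (K * (n * n) + 1))).
    rewrite /walk_cost -(size_steps d.1 p) -sum1_size big_distrl /=.
    by apply: leq_sum => e _; rewrite mul1n wt_bound.
  by rewrite leq_mul2r (leq_trans hsz) ?orbT // geq_minl.
split.
- move=> d hd; have [_ /(_ (hfin d hd))[[p [k1 k2 k3 k4] k5] _]] := hs d _ d.2 (hL d).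
  exists p; last by move=> e he; rewrite /chosen hd k5.
  split=> //; first by apply: leq_trans k3 _; exact: geq_minr.
  by apply: leq_trans k4 _; exact: geq_minl.
- move=> d p hd hp; have [_ /(_ (hfin d hd))[_ k]] := hs d _ d.2 (hL d).
  rewrite (eq_bigl (fun e => Q (pair_index (state_index d (Lbound d) d.2) e) != 0)); last first.
    by move=> e; rewrite /chosen hd.
  exact: leq_trans k (hcost d p hp).
by move=> d e /andP[].
Qed.

Definition p_round := PSeq (p_weights K) (PSeq (p_dp K hq) (p_update K hq)).

Lemma p_round_spec (R : realType) t s : (exists x : pair -> R, LP_feasible x) ->
  (forall e : pair, s aDL (idx e) = delta e) ->
  mwu R K t (table s aW) (table s aC) ->
  mwu R K t.+1 (table (run w p_round s) aW) (table (run w p_round s) aC).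
Proof.
move=> [x0 hx0] hdl hm.
pose s1 := run w (p_weights K) s; pose s2 := run w (p_dp K hq) s1.
have [f1 hT] := p_weights_spec s.
have hst : dp_store hq (wt K (table s aW)) s1.
  by split=> // e; rewrite /s1 f1.
have [hc hs] := p_dp_spec K hq_nonly hst.
have hex d : d \in demand I -> exists p, valid_path d p.
  by move=> hd; exact: feasible_valid_path hx0 hd.
have hg := dp_good hex hc hs.
have [_ hU] := p_update_spec s2.
have e1 d e : table s2 aW d e = table s aW d e by rewrite /s2 frame // /s1 f1.
have e2 d e : table s2 aC d e = table s aC d e by rewrite /s2 frame // /s1 f1.
have -> : table (run w p_round s) aW = fun d e => table s aW d e * (K + chosen (s2 aQ0) d e).
  by apply/funext => d; apply/funext => e; rewrite -e1; exact: (hU d e).1.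
have -> : table (run w p_round s) aC = fun d e => table s aC d e + chosen (s2 aQ0) d e.
  by apply/funext => d; apply/funext => e; rewrite -e2; exact: (hU d e).2.
exact: mwu_step.
Qed.

Lemma p_main_spec (R : realType) : (exists x : pair -> R, LP_feasible x) ->
  exists W C : pair -> pair -> nat, mwu R K (K * K.+1 * (n * n * (n * n))) W C /\
  forall e : pair, run w (p_main K hq) (fun _ _ => 0) aMX (idx e) = \max_d C d e.
Proof.
move=> hfeas.
rewrite /p_main run_seq; set s1 := run w (p_dist hq) _.
rewrite run_seq; set s2 := run w _ s1; rewrite run_seq -/p_round.
set N := K * K.+1 * (n * n * (n * n)).
have hN s : heval w s 0 (hT K) = N by [].
pose Inv k (s : store) := [/\ (forall e : pair, s aDL (idx e) = delta e), (forall l, s aMX l = 0)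
   & mwu R K (N - k) (table s aW) (table s aC)].
have : Inv 0 (run w (PIter iR (hT K) p_round) s2).
  apply: iter_ind => //.
    rewrite hN /Inv subnn; split.
    - by move=> e; rewrite /s2 frame // /s1 p_dist_spec.
    - by move=> l; rewrite /s2 frame // /s1 frame.
    have -> : table s2 aW = fun _ _ => 1.
      by apply/funext => d; apply/funext => e; rewrite /s2 run_tabE ?heval_n4 ?idx2_lt.
    have -> : table s2 aC = fun _ _ => 0.
      by apply/funext => d; apply/funext => e; rewrite /s2 frame // /s1 frame.
    exact: mwu_init.
  move=> k s hk hc _ [i1 i2 i3]; split.
  - by move=> e; rewrite frame.
  - by move=> l; rewrite frame.
  rewrite (_ : N - k = (N - k.+1).+1); first exact: p_round_spec.
  by rewrite hN in hk; rewrite subnSK.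
set s3 := run w _ s2; rewrite /Inv subn0 => -[_ h2 h3].
exists (table s3 aW), (table s3 aC); split=> // e.
rewrite (@fold_demands_spec maxn aMX aC hmax) //.
by move=> s j x y; rewrite heval_hmax.
Qed.

End Rounds.

(** * Choice of the constants and reading off the solution *)

Local Open Scope ring_scope.

(** Horner's scheme expresses the given length bound in the language. *)
Definition horner_hexp (s : seq nat) : hexp :=
  foldr (fun c e => HAdd (HMul e HN) (HC c)) (HC 0) s.

Lemma nonly_horner s : nonly (horner_hexp s).
Proof. by elim: s => //= c s ->. Qed.

Lemma hpoly_horner (q : {poly nat}) n : (hpoly (horner_hexp q)).[n] = q.[n].
Proof.
rewrite [RHS]/horner; elim: (polyseq q) => [|c s IH] /=; first by rewrite hornerC.
by rewrite hornerD hornerM hornerX hornerC IH.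
Qed.

Theorem theorem6 (R : realType) (eps : R) (eps_gt0 : 0 < eps) (q : {poly nat}) :
  exists (A : program) (T : {poly nat}),
    forall I : instance, lengths_within q I ->
      exists (t : nat) (s : memory),
        [/\ exec A (input_memory (encode I)) t s,
            (t <= T.[word_size (encode I)])%N
          & (exists x : pair_of I -> R, LP_feasible x) ->
            exists x : pair_of I -> R,
              [/\ represents s x, LP_feasible x
                & LP_objective x <= (1 + eps) * LP_value R I]].
Proof.
(* Any positive K >= 4 / eps will do. *)
have [K K_gt0 hK] : exists2 K, (0 < K)%N & 4 <= eps * K%:R.
  exists (Num.bound (4 / eps)).+1 => //.
  rewrite mulrC -ler_pdivrMr // ltW //; apply: (@lt_trans _ _ (Num.bound (4 / eps))%:R).
    by apply: archi_boundP; rewrite divr_ge0 // ltW.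
  by rewrite ltr_nat.
pose hq := horner_hexp q.
have hqn : nonly hq by exact: nonly_horner.
(* The numerators are the maxima in [aMX], the common denominator is the number of rounds. *)
have [A [T hA]] := @run_polytime _ aMX (hT K) (well_formed_main K hqn) isT isT.
exists A, T => I hlen.
have [t [s [h1 h2 h3]]] := hA (encode I) (size_encode I).
exists t, s; split=> // hfeas.
have hlen' (e : pair_of I) : e \in edge I -> (1 <= len e <= (hpoly hq).[nb_vertices I])%N.
  by rewrite hpoly_horner; exact: hlen.
have [W [C [hm hmx]]] := p_main_spec K_gt0 hqn hlen' hfeas.
set N := (K * K.+1 * _)%N in hm.
exists (fun e => (\max_d C d e)%:R / N%:R).
have [f1 f2] := mwu_final K_gt0 hm hfeas erefl hK (fun e => erefl).
split=> // u v k.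
have [e1 e2] := h3 k (idx_lt (u, v)).
have -> : s (2 * k).+1 = N by rewrite e2 /= !hornerM !hornerC !hornerX.
split; last by rewrite e1 -hmx.
by rewrite /N !muln_gt0 K_gt0 /=; have := pair_n_gt0 (u, v); rewrite muln_gt0 => /andP[-> _].
Qed.
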